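(* Let $M$ be a connected $C^\infty$ manifold without boundary endowed with a complete Riemannian metric, and let $H:T^*M\to\mathbb{R}$ be a $C^2$ function which is uniformly superlinear, uniformly bounded and $C^2$-strictly convex in the fibers (as defined in the context). Then there is $c(H)\in\mathbb{R}$ such that the Hamilton-Jacobi equation $H(x,d_xu)=c$ admits a global viscosity solution $u:M\to\mathbb{R}$ for $c=c(H)$ and does not admit any such solution for $c<c(H)$.
   Context: $\|\cdot\|$ denotes the norm on $T_xM$ given by the Riemannian metric and also the dual norm on $T^*_xM$. Points of $T^*M$ are written $(x,p)$ with $x\in M$, $p\in T_x^*M$. Conditions on $H$: - Uniform superlinearity: for every $K\ge 0$ there exists $C^*(K)\in\mathbb{R}$ such that $H(x,p)\ge K\|p\|-C^*(K)$ for all $(x,p)\in T^*M$. - Uniform boundedness: for every $R\ge 0$, $A^*(R)=\sup\{H(x,p)\mid \|p\|\le R\}<+\infty$. - $C^2$-strict convexity in the fibers: for every $(x,p)\in T^*M$, the second derivative along the fibers $\partial^2H/\partial p^2(x,p)$ is positive definite. Viscosity solutions: a continuous function $u:M\to\mathbb{R}$ is a viscosity subsolution (resp. supersolution) of $H(x,d_xu)=c$ if for each $C^1$ function $\phi:M\to\mathbb{R}$ such that $u-\phi$ admits a maximum (resp. minimum) at some $x_0\in M$, one has $H(x_0,d_{x_0}\phi)\le c$ (resp. $H(x_0,d_{x_0}\phi)\ge c$). It is a (global) viscosity solution if it is both a subsolution and a supersolution on $M$. *)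

(* Defs.v *)
From HB Require Import structures.
From mathcomp Require Import all_boot all_order all_algebra.
From mathcomp Require Import all_classical all_reals all_analysis.
Set Implicit Arguments.
Unset Strict Implicit.
Unset Printing Implicit Defensive.
Import Order.TTheory GRing.Theory Num.Theory numFieldNormedType.Exports.
Local Open Scope classical_set_scope.
Local Open Scope ring_scope.

(* All the uses below have a finite-dimensional V, where C^k can be tested on
   iterated directional derivatives. *)
Fixpoint Ck (R : realType) (V W : normedModType R) (k : nat) (U : set V)
    (f : V -> W) : Prop :=
  if k is k'.+1 then
    (forall x, U x -> differentiable f x) /\ (forall v : V, Ck k' U ('D_v f))
  else forall x, U x -> {for x, continuous f}.

Definition smooth (R : realType) (V W : normedModType R) (U : set V)
    (f : V -> W) : Prop := forall k, Ck k U f.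

Definition posdef (R : realType) (n : nat) (A : 'M[R]_n) : Prop :=
  A^T = A /\ forall v : 'rV[R]_n, v != 0 -> 0 < (v *m A *m v^T) 0 0.

Section Manifold.
Variables (R : realType) (n : nat) (M : topologicalType).

(* chart_map and chart_inv are total functions, meaningful only on the open
   sets chart_dom and chart_cod respectively. *)
Record chart : Type := Chart {
  chart_dom : set M;
  chart_cod : set 'rV[R]_n;
  chart_map :> M -> 'rV[R]_n;
  chart_inv : 'rV[R]_n -> M;
  chart_dom_open : open chart_dom;
  chart_cod_open : open chart_cod;
  chart_mapP : forall x, chart_dom x -> chart_cod (chart_map x);
  chart_invP : forall y, chart_cod y -> chart_dom (chart_inv y);
  chart_mapK : forall x, chart_dom x -> chart_inv (chart_map x) = x;
  chart_invK : forall y, chart_cod y -> chart_map (chart_inv y) = y;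
  chart_map_cont : forall x, chart_dom x -> {for x, continuous chart_map};
  chart_inv_cont : forall y, chart_cod y -> {for y, continuous chart_inv}
}.

(* chart_at selects a preferred chart around each point; it serves only to give
   coordinates to the elements of the tangent and cotangent spaces. *)
Record smooth_atlas : Type := SmoothAtlas {
  atlas : set chart;
  chart_at : M -> chart;
  chart_at_atlas : forall x, atlas (chart_at x);
  chart_at_dom : forall x, chart_dom (chart_at x) x;
  transition_smooth : forall e e', atlas e -> atlas e' ->
    smooth (chart_cod e `&` chart_inv e @^-1` chart_dom e') (e' \o chart_inv e)
}.

(* A tangent vector (resp. covector) at x is given by its row (resp. column) of
   components in the chart [chart_at A x]. *)
Definition tangent (A : smooth_atlas) (x : M) : Type := 'rV[R]_n.
Definition cotangent (A : smooth_atlas) (x : M) : Type := 'cV[R]_n.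

Variable A : smooth_atlas.

Definition pairing (x : M) (p : cotangent A x) (v : tangent A x) : R :=
  ((v : 'rV[R]_n) *m (p : 'cV[R]_n)) 0 0.

(* If v is the row of components of a tangent vector at x in the chart e, then
   v *m coord_change e e' x is its row of components in e'. If p is the column
   of components of a covector at x in e', then coord_change e e' x *m p is its
   column of components in e. *)
Definition coord_change (e e' : chart) (x : M) : 'M[R]_n :=
  jacobian (e' \o chart_inv e) (e x).

Definition C1_fun (phi : M -> R) : Prop :=
  forall e, atlas A e -> Ck 1 (chart_cod e) (phi \o chart_inv e).

Definition diff_at (phi : M -> R) (x : M) : cotangent A x :=
  \col_j 'D_(delta_mx 0 j) (phi \o chart_inv (chart_at A x)) (chart_at A x x).

Definition C1_curve (gamma : R -> M) : Prop :=
  continuous gamma /\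
  forall e, atlas A e -> Ck 1 (gamma @^-1` chart_dom e) (e \o gamma).

Definition velocity (gamma : R -> M) (t : R) : tangent A (gamma t) :=
  derive1 (chart_at A (gamma t) \o gamma) t.

Record riemannian_metric : Type := RiemannianMetric {
  metric_mx :> M -> 'M[R]_n;
  metric_posdef : forall x, posdef (metric_mx x);
  metric_smooth : forall e, atlas A e ->
    smooth (chart_cod e) (fun y => let x := chart_inv e y in
      coord_change e (chart_at A x) x *m metric_mx x
        *m (coord_change e (chart_at A x) x)^T)
}.

Variable g : riemannian_metric.

Definition tnorm (x : M) (v : tangent A x) : R :=
  Num.sqrt (((v : 'rV[R]_n) *m g x *m (v : 'rV[R]_n)^T) 0 0).

Definition dual_norm (x : M) (p : cotangent A x) : R :=
  sup [set `|pairing p v| | v in [set v : tangent A x | tnorm v <= 1]].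

Definition curve_length (gamma : R -> M) (a b : R) : R :=
  \int[lebesgue_measure]_(t in `[a, b]) tnorm (velocity gamma t).

(* [path_of_length x y l]: some piecewise C^1 path from x to y, presented as a
   finite chain of C^1 arcs, has length l. Arcs are restrictions to [a, b] of C^1
   curves defined on the whole line; every C^1 arc has such an extension. *)
Inductive path_of_length : M -> M -> R -> Prop :=
| path_nil x : path_of_length x x 0
| path_cons gamma a b y l : C1_curve gamma -> a <= b ->
    path_of_length (gamma b) y l ->
    path_of_length (gamma a) y (curve_length gamma a b + l).

Definition riemannian_dist (x y : M) : R :=
  inf [set l | path_of_length x y l].

Definition complete_metric : Prop :=
  forall u : nat -> M,
    (forall eps : R, 0 < eps -> exists N : nat, forall i j : nat,
       (N <= i)%N -> (N <= j)%N -> riemannian_dist (u i) (u j) < eps) ->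
    exists x : M, riemannian_dist (u k) x @[k --> \oo] --> (0 : R).

Variable H : forall x : M, cotangent A x -> R.

(* Each chart e of M induces the chart (y, q) of T^*M, where q is the column of
   components in e of a covector at chart_inv e y. *)
Definition C2_hamiltonian : Prop :=
  forall e, atlas A e ->
    Ck 2 (chart_cod e `*` [set: 'cV[R]_n])
      (fun z : 'rV[R]_n * 'cV[R]_n => let x := chart_inv e z.1 in
         H (coord_change (chart_at A x) e x *m z.2 : cotangent A x)).

Definition uniformly_superlinear : Prop :=
  forall K : R, 0 <= K -> exists C : R,
    forall (x : M) (p : cotangent A x), K * dual_norm p - C <= H p.

Definition sup_on_balls (r : R) : \bar R :=
  ereal_sup [set h | exists (x : M) (p : cotangent A x),
    dual_norm p <= r /\ h = (H p)%:E].

Definition uniformly_bounded : Prop :=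
  forall r : R, 0 <= r -> (sup_on_balls r < +oo)%E.

Definition fiber_hessian (x : M) (p : cotangent A x) : 'M[R]_n :=
  \matrix_(i, j) 'D_(delta_mx i 0)
    ('D_(delta_mx j 0) (@H x : 'cV[R]_n -> R)) (p : 'cV[R]_n).

Definition C2_strictly_convex : Prop :=
  forall (x : M) (p : cotangent A x), posdef (fiber_hessian p).

Definition viscosity_subsolution (u : M -> R) (c : R) : Prop :=
  continuous u /\
  forall (phi : M -> R) (x0 : M), C1_fun phi ->
    (forall x, u x - phi x <= u x0 - phi x0) -> H (diff_at phi x0) <= c.

Definition viscosity_supersolution (u : M -> R) (c : R) : Prop :=
  continuous u /\
  forall (phi : M -> R) (x0 : M), C1_fun phi ->
    (forall x, u x0 - phi x0 <= u x - phi x) -> c <= H (diff_at phi x0).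

Definition viscosity_solution (u : M -> R) (c : R) : Prop :=
  viscosity_subsolution u c /\ viscosity_supersolution u c.

End Manifold.

(* Main.v *)
(* Let S be the set of the c for which H(x, du) = c has a global solution; c(H)
   is the minimum of S. A continuous function is touched from above by C^1
   functions, so S is bounded below by inf H. Superlinearity makes subsolutions
   locally equi-Lipschitz in charts, hence equicontinuous, and stability of
   viscosity solutions under locally uniform limits makes S closed. For S to be
   nonempty, Perron's method solves lambda u + H(x, du) = 0 with lambda u between
   two constants independent of lambda. As lambda tends to 0 along an
   ultrafilter, connectedness of M keeps u - u(x0) locally bounded, so u - u(x0)
   converges locally uniformly while - lambda u converges to a constant, which
   belongs to S. *)
Require Import Defs.
From mathcomp Require Import all_boot all_order all_algebra.
From mathcomp Require Import all_classical all_reals all_analysis.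
From mathcomp Require Import ring lra.
Set Implicit Arguments.
Unset Strict Implicit.
Unset Printing Implicit Defensive.
Import Order.TTheory GRing.Theory Num.Theory numFieldNormedType.Exports.
Local Open Scope classical_set_scope.
Local Open Scope ring_scope.

(** The definition tests with global C^1 functions at global extrema, whereas every argument on
    solutions is local. A test function defined near a point is made global by gluing it to a C^1
    majorant of the solution; afterwards all tests are local. Distances are taken in charts and
    squared, because the maximum norm and the Riemannian distance need not be differentiable.
    Perron's method usually produces a semicontinuous supremum, whose continuity comes from a
    comparison principle. Here coercivity makes the subsolutions with a common upper bound on the
    right-hand side equicontinuous, so their supremum is continuous at once. The two constants
    around [- lambda * u] are a lower bound [c] of H, which the right-hand side of a subsolution
    cannot cross, and an upper bound [a] of H on the zero section, for which the constant
    [- a / lambda] is a subsolution. An ultrafilter gives limits at all points simultaneously, with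
    no diagonal extraction; equicontinuity and compact coordinate balls make them locally
    uniform. *)

(** * C^1 functions at a point of a normed space *)

Lemma differentiable_near_eq (R : realType) (V W : normedModType R)
    (f g : V -> W) (x : V) :
  {near x, f =1 g} -> differentiable f x -> differentiable g x.
Proof.
move=> fg df.
(* [g - f] vanishes near [x], so the zero map satisfies the expansion that characterises its
   differential. *)
suff dh : differentiable (g - f) x.
  by rewrite -[g](subrK f); apply: differentiableD.
pose zero : {linear V -> W} := \0.
have zc : continuous (zero : V -> W) by exact: cst_continuous.
have gfx : (g - f) x = 0.
  by rewrite -[LHS]/(g x - f x) (nbhs_singleton fg) subrr.
have E : (g - f) \o shift x = cst ((g - f) x) + zero +o_ 0 id.
  apply/eqaddoP => _ /posnumP[e].
  have := fg; rewrite (near_shift 0) subr0 => fg'.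
  near=> h; have -> : ((g - f) \o shift x - (cst ((g - f) x) + zero)) h =
    (g (h + x) - f (h + x)) - ((g - f) x + 0) by [].
  rewrite gfx addr0.
  have -> : g (h + x) = f (h + x) by apply/esym; near: h.
  by rewrite subrr subr0 normr0 mulr_ge0.
apply/diff_locallyP; rewrite (diff_unique zc E).
by split.
Unshelve. all: by end_near. Qed.

(** Differentiability is required near [x], but continuity of the derivatives only at [x]. At all
    points of an open set this amounts to [Ck 1], and it can be checked one point at a time. *)
Definition C1_at (R : realType) (V W : normedModType R) (f : V -> W) (x : V) :=
  (\forall y \near x, differentiable f y) /\
  forall v, {for x, continuous ('D_v f)}.

Section C1_at.
Context {R : realType} {V W : normedModType R}.
Implicit Types (f g : V -> W) (x : V).

Lemma C1_atP (U : set V) f : open U ->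
  Ck 1 U f <-> (forall x, U x -> C1_at f x).
Proof.
move=> oU; split=> [[df cf] x Ux|H].
  split; last by move=> v; exact: cf.
  by apply: filterS (open_nbhs_nbhs (conj oU Ux)) => y /df.
split=> [x /H[/nbhs_singleton //]|v x Ux]; exact: (H x Ux).2.
Qed.

Lemma C1_at_diff f x : C1_at f x -> differentiable f x.
Proof. by case=> /nbhs_singleton. Qed.

Lemma C1_at_cont f x : C1_at f x -> {for x, continuous f}.
Proof. by move=> /C1_at_diff; exact: differentiable_continuous. Qed.

Lemma near_eq_cont (T T' : topologicalType) (f g : T -> T') (x : T) :
  {near x, f =1 g} -> {for x, continuous f} -> {for x, continuous g}.
Proof.
move=> fg cf; have E : f x = g x := nbhs_singleton fg.
change (g @ x --> g x); rewrite -E.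
apply: cvg_trans cf; apply: near_eq_cvg.
by apply: filterS fg => y ->.
Qed.

Lemma C1_at_near_eq f g x : {near x, f =1 g} -> C1_at f x -> C1_at g x.
Proof.
move=> /[dup] fg /near_join fg' [df cf]; split.
  near=> y; apply: (@differentiable_near_eq _ _ _ f); last by near: y.
  by near: y.
move=> v; apply: near_eq_cont (cf v).
near=> y; apply: near_eq_derive.
by near: y.
Unshelve. all: by end_near. Qed.

Lemma C1_at_cst (a : W) x : C1_at (cst a) x.
Proof.
split; first by near=> y; exact: differentiable_cst.
move=> v; rewrite (_ : 'D_v (cst a) = cst 0); first exact: cst_continuous.
by apply/funext => y; rewrite derive_cst.
Unshelve. all: by end_near. Qed.

Lemma C1_atD f g x : C1_at f x -> C1_at g x -> C1_at (f \+ g) x.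
Proof.
move=> [df cf] [dg cg]; split.
  by near=> y; apply: differentiableD; near: y.
move=> v; apply: (@near_eq_cont _ _ ('D_v f \+ 'D_v g)).
  near=> y; rewrite /= deriveD//; apply: diff_derivable; by near: y.
by apply: continuousD; [exact: cf|exact: cg].
Unshelve. all: by end_near. Qed.

Lemma C1_atN f x : C1_at f x -> C1_at (\- f) x.
Proof.
move=> [df cf]; split.
  by near=> y; apply: differentiableN; near: y.
move=> v; apply: (@near_eq_cont _ _ (\- 'D_v f)).
  near=> y; rewrite /= deriveN//; apply: diff_derivable; by near: y.
by apply: continuousN; exact: cf.
Unshelve. all: by end_near. Qed.

End C1_at.

Lemma C1_atM (R : realType) (V : normedModType R) (f g : V -> R) x :
  C1_at f x -> C1_at g x -> C1_at (f \* g) x.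
Proof.
move=> fx gx; have [df cf] := fx; have [dg cg] := gx; split.
  by near=> y; apply: differentiableM; near: y.
move=> v; apply: (@near_eq_cont _ _ (fun y => f y * 'D_v g y + g y * 'D_v f y)).
  near=> y; rewrite /= deriveM//; apply: diff_derivable; by near: y.
apply: continuousD; apply: continuousM.
- exact: (C1_at_cont fx).
- exact: cg.
- exact: (C1_at_cont gx).
- exact: cf.
Unshelve. all: by end_near. Qed.

Lemma C1_at_sum (R : realType) (V W : normedModType R) n (f : 'I_n -> V -> W) x :
  (forall i, C1_at (f i) x) -> C1_at (fun y => \sum_i f i y) x.
Proof.
elim: n f => [|n IH] f fx.
  apply: (@C1_at_near_eq _ _ _ (cst 0)); last exact: C1_at_cst.
  by near=> y; rewrite big_ord0.
apply: (@C1_at_near_eq _ _ _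
    ((fun y => \sum_i f (widen_ord (leqnSn n) i) y) \+ f ord_max)).
  by near=> y; rewrite big_ord_recr.
by apply: C1_atD => //; exact: IH.
Unshelve. all: by end_near. Qed.


Lemma continuous_at_sum (R : realType) (T : topologicalType) n
    (f : 'I_n -> T -> R) (x : T) :
  (forall i, {for x, continuous (f i)}) ->
  {for x, continuous (fun y => \sum_i f i y)}.
Proof.
by move=> cf; apply: (cvg_big add_continuous) => i _; exact: cf.
Qed.

(** * Chain rule and gradients *)

Section Chain.
Variables (R : realType).

Definition grad n (f : 'rV[R]_n -> R) (y : 'rV[R]_n) : 'cV[R]_n :=
  \col_j 'D_(delta_mx 0 j) f y.

Lemma derive_grad n (f : 'rV[R]_n -> R) y v :
  differentiable f y -> 'D_v f y = (v *m grad f y) 0 0.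
Proof.
move=> df; rewrite deriveE// {1}(row_sum_delta v) linear_sum !mxE.
by apply: eq_bigr => j _; rewrite linearZ !mxE deriveE.
Qed.

(** The chain rule is expanded over the coordinates of ['D_v T]: continuity at [x] then concerns a
    finite sum of products of scalar functions. *)
Lemma C1_at_comp_row (V : normedModType R) m (T : V -> 'rV[R]_m)
    (f : 'rV[R]_m -> R) x :
  C1_at T x -> C1_at f (T x) -> C1_at (f \o T) x.
Proof.
move=> Tx fTx; have [dT cT] := Tx; have [df cf] := fTx.
have cTx := C1_at_cont Tx.
have dfT : \forall y \near x, differentiable f (T y) by exact: (cTx _ df).
split; first by near=> y; apply: differentiable_comp; near: y.
move=> v; apply: (@near_eq_cont _ _
  (fun y => \sum_j ('D_v T y 0 j * 'D_(delta_mx 0 j) f (T y)))).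
  near=> y.
  have dTy : differentiable T y by near: y.
  have dfTy : differentiable f (T y) by near: y.
  rewrite [RHS](deriveE _ (differentiable_comp dTy dfTy)) diff_comp//.
  rewrite -[RHS]/('d f (T y) ('d T y v)) -(deriveE _ dfTy) derive_grad// !mxE -(deriveE _ dTy).
  by apply: eq_bigr => j _; rewrite !mxE.
apply: (@continuous_at_sum _ _ _
  (fun j y => 'D_v T y 0 j * 'D_(delta_mx 0 j) f (T y))) => j.
apply: continuousM.
  apply: (@continuous_comp _ _ _ ('D_v T) (fun w : 'rV[R]_m => w 0 j)).
    exact: cT.
  exact: coord_continuous.
apply: (@continuous_comp _ _ _ T ('D_(delta_mx 0 j) f)); [exact: cTx|exact: cf].
Unshelve. all: by end_near. Qed.

Lemma C1_at_comp1 (V : normedModType R) (s : V -> R) (h : R -> R) x :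
  C1_at s x -> C1_at h (s x) -> C1_at (h \o s) x.
Proof.
move=> sx hsx; have [ds cs] := sx; have [dh ch] := hsx.
have csx := C1_at_cont sx.
have dhs : \forall y \near x, differentiable h (s y) by exact: (csx _ dh).
split; first by near=> y; apply: differentiable_comp; near: y.
move=> v; apply: (@near_eq_cont _ _
  (fun y => 'D_v s y * 'D_1 h (s y))).
  near=> y.
  have dTy : differentiable s y by near: y.
  have dfTy : differentiable h (s y) by near: y.
  rewrite [RHS](deriveE _ (differentiable_comp dTy dfTy)) diff_comp//.
  rewrite -[RHS]/('d h (s y) ('d s y v)) -(deriveE _ dTy).
  by rewrite -[in RHS](mulr1 ('D_v s y)) linearZ/= -deriveE.
apply: continuousM; first exact: cs.
apply: (@continuous_comp _ _ _ s ('D_1 h)); [exact: csx|exact: ch].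
Unshelve. all: by end_near. Qed.

Lemma derive_comp1 (V : normedModType R) (s : V -> R) (h : R -> R) x v (dh : R) :
  differentiable s x -> is_derive (s x) 1 h dh -> 'D_v (h \o s) x = 'D_v s x * dh.
Proof.
move=> ds [/derivable1_diffP hd <-].
rewrite [LHS](deriveE _ (differentiable_comp ds hd)) diff_comp//.
rewrite -[LHS]/('d h (s x) ('d s x v)) -(deriveE _ ds).
by rewrite -[in LHS](mulr1 ('D_v s x)) linearZ/= -deriveE.
Qed.

Lemma C1_at_is_derive (h h1 : R -> R) (t : R) :
  (\forall t' \near t, is_derive (t' : R) (1 : R) h (h1 t')) -> {for t, continuous h1} ->
  C1_at h t.
Proof.
move=> hd ch; split.
  by apply: filterS hd => y [/derivable1_diffP].
move=> v; apply: (@near_eq_cont _ _ (fun y => v * h1 y)).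
  apply: filterS hd => y [/derivable1_diffP d <-].
  by rewrite !deriveE// -[in RHS](mulr1 v) linearZ.
by apply: continuousM => //; exact: cst_continuous.
Qed.

End Chain.

(** * Fermat's rule *)

Section Fermat.
Context {R : realType} {V : normedModType R}.

(** Along the line [t *: v + y] this is the one-variable rule at an interior maximum. *)
Lemma derive_local_max (f : V -> R) y v : C1_at f y ->
  (\forall z \near y, f z <= f y) -> 'D_v f y = 0.
Proof.
move=> [df _] fy.
pose l (t : R) : V := t *: v + y.
have cl : {for 0, continuous l}.
  apply: (@continuousD _ _ _ (fun t : R => t *: v) (fun=> y)).
    exact: scalel_continuous.
  exact: cst_continuous.
have l0 : l 0 = y by rewrite /l scale0r add0r.
have /cl : nbhs (l 0) [set z | f z <= f y /\ differentiable f z].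
  by rewrite l0; apply: filterS2 fy df.
case=> e /= e0 He.
have ball_e t : t \in `]-e, e[ -> f (l t) <= f y /\ differentiable f (l t).
  rewrite in_itv/= => te; apply: He.
  by rewrite /= sub0r normrN ltr_norml.
have -> : 'D_v f y = 'D_1 (f \o l) 0.
  rewrite /derive; set g1 := fun h => h^-1 *: _; set g2 := fun h => h^-1 *: _.
  suff -> : g1 = g2 by [].
  by apply/funext => h; rewrite /g1 /g2 /= /l addr0 scale0r add0r [_%:A]mulr1.
have dl t : differentiable l t.
  apply: (@differentiableD _ _ _ (fun t : R => t *: v) (fun=> y)).
    exact: ex_diff.
  exact: differentiable_cst.
suff : is_derive (0 : R) 1 (f \o l) 0 by move=> ?; exact: derive_val.
apply: (@derive1_at_max _ _ (- e) e).
- by rewrite (@le_trans _ _ 0) ?oppr_le0 ?ltW.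
- move=> t /ball_e[_ dft]; apply/derivable1_diffP.
  exact: differentiable_comp.
- by rewrite in_itv/= oppr_lt0 e0.
- by move=> t /ball_e[+ _]; rewrite /= l0.
Qed.

End Fermat.

(** * Squared Euclidean distance *)

Section SquaredDistance.
Context {R : realType} {n : nat}.
Implicit Types (y z : 'rV[R]_n) (q : 'cV[R]_n).

(** The norm of row vectors is the maximum norm, which is not differentiable; this square is C^1
    everywhere and has the same neighbourhoods. *)
Definition sqd y z : R := \sum_i (z 0 i - y 0 i) ^+ 2.

Definition csq q : R := \sum_i q i 0 ^+ 2.

Lemma is_derive_sqd y z v :
  is_derive z v (sqd y) (\sum_i (2 * (z 0 i - y 0 i) * v 0 i)).
Proof.
have -> : sqd y = \sum_i (fun w : 'rV[R]_n => (w 0 i - y 0 i) ^+ 2).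
  by apply/funext => w; rewrite fct_sumE.
apply: is_derive_sum => i.
have dc : is_derive z v (fun w : 'rV[R]_n => w 0 i) (v 0 i).
  have @f : {linear 'rV[R]_n -> R}.
    by exists (fun N : 'rV[R]_n => N 0 i); do 2![eexists]; do ?[constructor];
     rewrite ?mxE// => ? *; rewrite ?mxE//; move=> ?; rewrite !mxE.
  have cf : continuous f by exact: coord_continuous.
  have df : differentiable f z by exact: linear_differentiable.
  split; first exact: diff_derivable.
  by rewrite deriveE// (diff_lin _ cf).
have -> : (fun w : 'rV[R]_n => (w 0 i - y 0 i) ^+ 2) =
          (((fun w : 'rV[R]_n => w 0 i) - cst (y 0 i)) ^+ 2).
  by apply/funext => w; rewrite !fctE.
apply: is_derive_eq.
by rewrite !fctE subr0 expr1 /GRing.scale/=.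
Qed.

Lemma C1_at_coord i z : C1_at (fun w : 'rV[R]_n => w 0 i) z.
Proof.
have @f : {linear 'rV[R]_n -> R}.
  by exists (fun N : 'rV[R]_n => N 0 i); do 2![eexists]; do ?[constructor];
   rewrite ?mxE// => ? *; rewrite ?mxE//; move=> ?; rewrite !mxE.
have cf : continuous f by exact: coord_continuous.
have df w : differentiable f w by exact: linear_differentiable.
split; first by near=> w; exact: df.
move=> v; apply: (@near_eq_cont _ _ (cst (f v))); last exact: cst_continuous.
by near=> w; rewrite deriveE// (diff_lin _ cf).
Unshelve. all: by end_near. Qed.

Lemma C1_at_sqd y z : C1_at (sqd y) z.
Proof.
apply: C1_at_sum => i.
have c : C1_at ((fun w : 'rV[R]_n => w 0 i) \+ cst (- y 0 i)) z.
  by apply: C1_atD; [exact: C1_at_coord|exact: C1_at_cst].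
exact: (C1_atM c c).
Qed.

Lemma sqd_cont y : continuous (sqd y).
Proof. by move=> z; exact: (C1_at_cont (C1_at_sqd y z)). Qed.

Lemma grad_radial (h : R -> R) (dh : R) y z :
  is_derive (sqd y z) 1 h dh -> grad (h \o sqd y) z = (2 * dh) *: (z - y)^T.
Proof.
move=> hd; apply/matrixP => j k; rewrite !mxE.
rewrite (derive_comp1 _ _ hd); last exact: (C1_at_diff (C1_at_sqd y z)).
have := is_derive_sqd y z (delta_mx 0 j) => -[_ ->].
rewrite (bigD1 j)//= big1 ?addr0 => [|i /negbTE ij]; last first.
  by rewrite mxE eqxx/= ij mulr0.
by rewrite mxE !eqxx !mulr1 [in RHS]mulrAC ord1.
Qed.

Lemma csq_ge0 q : 0 <= csq q.
Proof. by apply: sumr_ge0 => i _; exact: sqr_ge0. Qed.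

Lemma csqZ (a : R) q : csq (a *: q) = a ^+ 2 * csq q.
Proof.
by rewrite /csq mulr_sumr; apply: eq_bigr => i _; rewrite mxE exprMn.
Qed.

Lemma csq_sqd y z : csq (z - y)^T = sqd y z.
Proof. by apply: eq_bigr => i _; rewrite !mxE. Qed.

Lemma sqd_ge0 y z : 0 <= sqd y z.
Proof. by rewrite -csq_sqd csq_ge0. Qed.

Lemma sqdxx y : sqd y y = 0.
Proof. by rewrite /sqd big1// => i _; rewrite subrr expr0n. Qed.

Lemma sqdC y z : sqd y z = sqd z y.
Proof. by apply: eq_bigr => i _; rewrite -sqrrN opprB. Qed.

Lemma sqd_coord y z i : (z 0 i - y 0 i) ^+ 2 <= sqd y z.
Proof.
by rewrite /sqd (bigD1 i)//= lerDl; apply: sumr_ge0 => j _; exact: sqr_ge0.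
Qed.

Lemma sqd_eq0 y z : sqd y z <= 0 -> z = y.
Proof.
move=> s0; apply/matrixP => i j; rewrite ord1; apply/eqP.
rewrite -subr_eq0 -sqrf_eq0 eq_le sqr_ge0 andbT.
exact: le_trans (sqd_coord y z j) s0.
Qed.

Lemma sqd_triangle x y z : sqd x z <= 2 * sqd x y + 2 * sqd y z.
Proof.
rewrite /sqd !mulr_sumr -big_split/=; apply: ler_sum => i _.
have : 0 <= ((z 0 i - y 0 i) - (y 0 i - x 0 i)) ^+ 2 by exact: sqr_ge0.
by nra.
Qed.

Lemma mx_norm_sqd y z (e : R) : 0 < e -> sqd y z < e ^+ 2 -> `|z - y| < e.
Proof.
move=> e0 s; rewrite [ltLHS]/Num.norm/= mx_normrE.
apply/bigmax_ltP; split => // -[i j] _ /=; rewrite !mxE ord1.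
rewrite -(@ltr_pXn2r _ 2)// ?nnegrE ?normr_ge0 ?ltW// -normrX ger0_norm ?sqr_ge0//.
exact: le_lt_trans (sqd_coord y z j) s.
Qed.

Lemma sqd_nbhs y (N : set 'rV[R]_n) : nbhs y N ->
  exists2 r : R, 0 < r & forall z, sqd y z < r -> N z.
Proof.
move=> /nbhs_ballP[e /= e0 eN]; exists (e ^+ 2) => [|z sz]; first exact: exprn_gt0.
by apply: eN; rewrite -ball_normE/= distrC; exact: mx_norm_sqd.
Qed.

Lemma compact_sqd y (r : R) : compact [set z | sqd y z <= r].
Proof.
apply: bounded_closed_compact; last first.
  apply: (@closed_comp _ _ (sqd y) [set t : R | t <= r]).
    by move=> z _; exact: sqd_cont.
  exact: closed_le.
have [r0|r0] := ltP r 0.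
  exists 0; split; first exact: real0.
  move=> x _ z /= zr; have := sqd_ge0 y z; lra.
pose b := `|y| + (r + 1).
exists b; split; first exact: num_real.
move=> x bx z /= zr; apply/ltW/(lt_trans _ bx).
rewrite -(subrK y z) addrC; apply: le_lt_trans (ler_normD _ _) _.
rewrite ltrD2l; apply: mx_norm_sqd; first by lra.
by apply: (le_lt_trans zr); nra.
Qed.

End SquaredDistance.

(** * C^1 truncations on the line *)

Section Truncation.
Context {R : realType}.

Definition pos_sq (t : R) : R := Num.max 0 t ^+ 2.

(** A quadratic remainder is a polynomial inequality on each piece, so [pos_sq] can be
    differentiated at its kink without one-sided limits. *)
Lemma is_derive_quadratic_error (f : R -> R) (a t C : R) :
  (forall h, `|f (h + t) - f t - h * a| <= C * h ^+ 2) -> is_derive t 1 f a.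
Proof.
move=> H.
have C0 : 0 <= C by have := le_trans (normr_ge0 _) (H 1); lra.
suff L : (fun h => h^-1 *: ((f \o shift t) (h *: (1 : R)) - f t)) @ 0^' --> a.
  split; last exact: cvg_lim L.
  by apply/cvg_ex; exists a.
apply/cvgrPdist_le => /= e e0; near=> h.
have h0 : h != 0 by near: h; exact: nbhs_dnbhs_neq.
(* [C + 1] in place of [C], which may be zero. *)
have hC : `|h| <= e / (C + 1).
  near: h; apply: dnbhs0_le; by rewrite divr_gt0//; lra.
rewrite /GRing.scale/= mulr1.
have -> : a - h^-1 * (f (h + t) - f t) = - (h^-1 * (f (h + t) - f t - h * a)).
  by field.
rewrite normrN normrM normfV ler_pdivrMl ?normr_gt0//.
apply: le_trans (H h) _; rewrite -normr_id -[h ^+ 2]real_normK ?num_real//.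
rewrite expr2 mulrA normr_id [leRHS]mulrC ler_wpM2r//.
move: hC; rewrite ler_pdivlMr; [|by lra]; have := normr_ge0 h; nra.
Unshelve. all: by end_near. Qed.

Lemma is_derive_pos_sq (t : R) : is_derive t 1 pos_sq (2 * Num.max 0 t).
Proof.
apply: (@is_derive_quadratic_error _ _ _ 1) => h; rewrite /pos_sq mul1r ler_norml.
rewrite !maxEle; case: ifP => [|/negbT]; case: ifP => [|/negbT];
  rewrite -?ltNge => a b; apply/andP; split; nra.
Qed.

Lemma C1_at_pos_sq (t : R) : C1_at pos_sq t.
Proof.
apply: (@C1_at_is_derive _ _ (fun t => 2 * Num.max 0 t)).
  by near=> s; exact: is_derive_pos_sq.
apply: continuousM; first exact: cst_continuous.
apply: (@continuous_max _ _ (cst 0) id); first exact: cst_continuous.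
by move=> ?; exact.
Unshelve. all: by end_near. Qed.

Lemma pos_sq0 (t : R) : t <= 0 -> pos_sq t = 0.
Proof. by move=> t0; rewrite /pos_sq max_l// expr0n. Qed.

Lemma pos_sqE (t : R) : 0 <= t -> pos_sq t = t ^+ 2.
Proof. by move=> t0; rewrite /pos_sq max_r. Qed.

Lemma pos_sq_ge0 (t : R) : 0 <= pos_sq t.
Proof. exact: sqr_ge0. Qed.

(** A C^1 cutoff. For [t <= 1] the inner square is at least 1 and the outer one vanishes; for
    [t >= 2] the inner one vanishes. *)
Definition step (t : R) : R := 1 - pos_sq (1 - pos_sq (2 - t)).

Lemma step_le1 t : t <= 1 -> step t = 1.
Proof.
move=> t1; rewrite /step [pos_sq (1 - _)]pos_sq0 ?subr0//.
by rewrite pos_sqE; nra.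
Qed.

Lemma step_ge2 t : 2 <= t -> step t = 0.
Proof.
move=> t2; rewrite /step [pos_sq (2 - _)]pos_sq0; last by lra.
by rewrite pos_sqE ?subr0// expr1n subrr.
Qed.

Lemma step01 t : 0 <= step t <= 1.
Proof.
rewrite /step; have := pos_sq_ge0 (2 - t); set a := pos_sq (2 - t) => a0.
have := pos_sq_ge0 (1 - a).
have [a1|a1] := leP a 1; last by rewrite pos_sq0; lra.
by rewrite pos_sqE; nra.
Qed.

Lemma C1_at_step (t : R) : C1_at step t.
Proof.
have aff (c s : R) : C1_at (cst c \+ \- (id : R -> R)) s.
  apply: C1_atD; [exact: C1_at_cst|apply: C1_atN].
  apply: (@C1_at_is_derive _ _ (cst 1)); last exact: cst_continuous.
  by near=> u; exact: is_derive_id.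
have -> : step = (cst 1 \+ \- id) \o (pos_sq \o ((cst 1 \+ \- id) \o
   (pos_sq \o (cst 2 \+ \- id)))) by [].
do 4![apply: C1_at_comp1; last by [exact: aff|exact: C1_at_pos_sq]].
exact: aff.
Unshelve. all: by end_near. Qed.

End Truncation.

Lemma Ck1_C1_at (R : realType) (V W : normedModType R) (U : set V)
    (f : V -> W) x : nbhs x U -> Ck 1 U f -> C1_at f x.
Proof.
move=> Ux [df cf]; split; first by apply: filterS Ux => y /df.
by move=> v; apply: cf; exact: nbhs_singleton.
Qed.

Lemma continuous_at_mx (R : realType) (T : topologicalType) m n
    (f : T -> 'M[R]_(m, n)) x :
  (forall i j, {for x, continuous (fun y => f y i j)}) -> {for x, continuous f}.
Proof.
move=> cf N [e e0 eN].
have : \forall y \near x, forall i j, e i j (f y i j).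
  by apply: filter_forall => i; apply: filter_forall => j; exact: cf.
by apply: filterS => y ey; exact: eN.
Qed.

(** * Differentials and Hamiltonians in charts *)

Section Manifold.
Variables (R : realType) (n : nat) (M : topologicalType) (A : smooth_atlas R n M).
Implicit Types (e : chart R n M) (x z : M) (phi : M -> R).

Lemma nbhs_dom e x : chart_dom e x -> nbhs x (chart_dom e).
Proof. by move=> ex; apply: open_nbhs_nbhs; split => //; exact: chart_dom_open. Qed.

Lemma nbhs_cod e x : chart_dom e x -> nbhs (e x) (chart_cod e).
Proof.
move=> ex; apply: open_nbhs_nbhs; split; [exact: chart_cod_open|exact: chart_mapP].
Qed.

Lemma near_chart_inv e x (P : set M) : chart_dom e x ->
  nbhs x P -> \forall y \near e x, P (chart_inv e y).
Proof.
move=> ex Px.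
have : chart_inv e @ e x --> chart_inv e (e x) :=
  chart_inv_cont (chart_mapP ex).
by rewrite (chart_mapK ex) => /(_ _ Px).
Qed.

Lemma near_chart_map e x (P : set 'rV[R]_n) : chart_dom e x ->
  nbhs (e x) P -> \forall z \near x, P (e z).
Proof. by move=> ex Px; exact: (chart_map_cont ex Px). Qed.

(* Unlike [C1_loc], this is not an open condition on x. *)
Definition C1_near phi x := forall e, atlas A e -> chart_dom e x ->
  C1_at (phi \o chart_inv e) (e x).

Definition C1_loc phi x := \forall z \near x, C1_near phi z.

Lemma C1_funP phi : C1_fun A phi <-> forall x, C1_near phi x.
Proof.
split=> [H x e Ae ex|H e Ae].
  by apply: Ck1_C1_at (H e Ae); exact: nbhs_cod.
apply/C1_atP; first exact: chart_cod_open.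
move=> y ey; rewrite -(chart_invK ey).
by apply: H => //; exact: chart_invP.
Qed.

Lemma transition_C1 e e' x : atlas A e -> atlas A e' -> chart_dom e x ->
  chart_dom e' x -> C1_at (e' \o chart_inv e) (e x).
Proof.
move=> Ae Ae' ex ex'.
apply: (Ck1_C1_at _ (transition_smooth Ae Ae' 1%N)).
apply: filterI; first exact: nbhs_cod.
by apply: near_chart_inv => //; exact: nbhs_dom.
Qed.

Lemma C1_near_chart e x (f : 'rV[R]_n -> R) : atlas A e -> chart_dom e x ->
  C1_at f (e x) -> C1_near (f \o e) x.
Proof.
move=> Ae ex fx e' Ae' ex'.
have -> : (f \o e) \o chart_inv e' = f \o (e \o chart_inv e') by [].
refine (C1_at_comp_row (transition_C1 Ae' Ae ex' ex) _).
by rewrite /= chart_mapK.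
Qed.

Lemma C1_near_eq phi psi x : {near x, phi =1 psi} -> C1_near phi x ->
  C1_near psi x.
Proof.
move=> ff fx e Ae ex; apply: C1_at_near_eq (fx e Ae ex).
exact: (near_chart_inv ex ff).
Qed.

Lemma C1_near_cst (a : R) x : C1_near (cst a) x.
Proof. by move=> e _ _; exact: C1_at_cst. Qed.

Lemma C1_nearD phi psi x : C1_near phi x -> C1_near psi x ->
  C1_near (phi \+ psi) x.
Proof. by move=> f g e Ae ex; apply: C1_atD; [exact: f|exact: g]. Qed.

Lemma C1_nearN phi x : C1_near phi x -> C1_near (\- phi) x.
Proof. by move=> f e Ae ex; apply: C1_atN; exact: f. Qed.

Lemma C1_nearM phi psi x : C1_near phi x -> C1_near psi x ->
  C1_near (phi \* psi) x.
Proof. by move=> f g e Ae ex; apply: C1_atM; [exact: f|exact: g]. Qed.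

Lemma C1_near_cont phi x : C1_near phi x -> {for x, continuous phi}.
Proof.
move=> fx; have ex := chart_at_dom A x.
have c := C1_at_cont (fx _ (chart_at_atlas A x) ex).
have : {for x, continuous ((phi \o chart_inv (chart_at A x)) \o chart_at A x)}.
  by apply: (@continuous_comp _ _ _ (chart_at A x)) => //; exact: chart_map_cont.
apply: near_eq_cont; near=> z; rewrite /= chart_mapK//; near: z; exact: nbhs_dom.
Unshelve. all: by end_near. Qed.

(** The chart [chart_at A x] may jump as [x] moves. The chain rule passes to a fixed chart [e], in
    which the gradient can depend continuously on the point. *)
Lemma diff_at_chart phi e x : atlas A e -> chart_dom e x -> C1_near phi x ->
  diff_at A phi x =
  coord_change (chart_at A x) e x *m grad (phi \o chart_inv e) (e x).
Proof.
move=> Ae ex fx; set e0 := chart_at A x.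
have Ae0 : atlas A e0 := chart_at_atlas A x.
have ex0 : chart_dom e0 x := chart_at_dom A x.
have dT := C1_at_diff (transition_C1 Ae0 Ae ex0 ex).
have df := C1_at_diff (fx e Ae ex).
have Tx : (e \o chart_inv e0) (e0 x) = e x by rewrite /= chart_mapK.
have df' : differentiable (phi \o chart_inv e) ((e \o chart_inv e0) (e0 x)).
  by rewrite Tx.
apply/matrixP => j k; rewrite (ord1 k) {k} mxE.
transitivity ('D_(delta_mx 0 j) ((phi \o chart_inv e) \o (e \o chart_inv e0)) (e0 x)).
  apply: near_eq_derive.
  have := near_chart_inv ex0 (nbhs_dom ex); apply: filterS => y ey /=.
  by rewrite chart_mapK.
rewrite [LHS](deriveE _ (differentiable_comp dT df')) diff_comp//.
rewrite -[LHS]/('d (phi \o chart_inv e) ((e \o chart_inv e0) (e0 x))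
  ('d (e \o chart_inv e0) (e0 x) (delta_mx 0 j))).
rewrite -(deriveE _ df') derive_grad// -(deriveE _ dT) deriveEjacobian// Tx.
by rewrite -mulmxA -rowE mxE.
Qed.

Lemma coord_changeK e e' x : atlas A e -> atlas A e' -> chart_dom e x ->
  chart_dom e' x -> coord_change e e' x *m coord_change e' e x = 1%:M.
Proof.
move=> Ae Ae' ex ex'.
have dT := C1_at_diff (transition_C1 Ae Ae' ex ex').
have dT' := C1_at_diff (transition_C1 Ae' Ae ex' ex).
have Tx : (e' \o chart_inv e) (e x) = e' x by rewrite /= chart_mapK.
have dT2 : differentiable (e \o chart_inv e') ((e' \o chart_inv e) (e x)).
  by rewrite Tx.
apply/row_matrixP => j; rewrite !rowE mulmx1 mulmxA.
rewrite -[_ *m coord_change e e' x]deriveEjacobian// (deriveE _ dT).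
rewrite -deriveEjacobian// -Tx (deriveE _ dT2).
rewrite -[LHS]/(('d (e \o chart_inv e') ((e' \o chart_inv e) (e x)) \o
  'd (e' \o chart_inv e) (e x)) (delta_mx 0 j)) -diff_comp//.
rewrite -(deriveE _ (differentiable_comp dT dT2)).
transitivity ('D_(delta_mx 0 j) (id : 'rV[R]_n -> 'rV[R]_n) (e x)); last exact: derive_id.
apply: near_eq_derive; near=> y; rewrite /=.
rewrite [chart_inv e' _]chart_mapK ?chart_invK//.
  by near: y; exact: nbhs_cod.
by near: y; apply: near_chart_inv => //; exact: nbhs_dom.
Unshelve. all: by end_near. Qed.

Lemma diff_atD phi psi x : C1_near phi x -> C1_near psi x ->
  diff_at A (phi \+ psi) x = diff_at A phi x + diff_at A psi x :> 'cV[R]_n.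
Proof.
move=> fx gx; have ex := chart_at_dom A x; have Ae := chart_at_atlas A x.
apply/matrixP => i j; rewrite !mxE.
by apply: deriveD; apply: diff_derivable; apply: C1_at_diff; [exact: fx|exact: gx].
Qed.

Lemma diff_atN phi x : C1_near phi x ->
  diff_at A (\- phi) x = - diff_at A phi x :> 'cV[R]_n.
Proof.
move=> fx; have ex := chart_at_dom A x; have Ae := chart_at_atlas A x.
apply/matrixP => i j; rewrite !mxE.
by apply: deriveN; apply: diff_derivable; apply: C1_at_diff; exact: fx.
Qed.

Lemma diff_at_near_eq phi psi x : {near x, phi =1 psi} ->
  diff_at A phi x = diff_at A psi x :> 'cV[R]_n.
Proof.
move=> ff; have ex := chart_at_dom A x.
apply/matrixP => i j; rewrite !mxE.
by apply: near_eq_derive; exact: (near_chart_inv ex ff).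
Qed.

Lemma diff_at_cst (a : R) x : diff_at A (cst a) x = 0 :> 'cV[R]_n.
Proof. by apply/matrixP => i j; rewrite !mxE derive_cst. Qed.

Lemma diff_at_max phi x : C1_near phi x ->
  (\forall z \near x, phi z <= phi x) -> diff_at A phi x = 0 :> 'cV[R]_n.
Proof.
move=> fx mx; have ex := chart_at_dom A x; have Ae := chart_at_atlas A x.
apply/matrixP => i j; rewrite !mxE; apply: derive_local_max; first exact: fx.
by rewrite /= chart_mapK//; exact: (near_chart_inv ex mx).
Qed.

(** The cotangent bundle is not given a topology; continuity is read in the charts [(y, q)] that [e]
    induces on it. *)
Definition hamiltonian_cont (K : forall x : M, cotangent A x -> R) :=
  forall e, atlas A e -> forall (y : 'rV[R]_n) (q : 'cV[R]_n), chart_cod e y ->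
  {for (y, q), continuous
    (fun z : 'rV[R]_n * 'cV[R]_n => let x := chart_inv e z.1 in
         K x (coord_change (chart_at A x) e x *m z.2 : cotangent A x))}.

(** Serves to extend a strict inequality on [K x (diff_at A phi x)] to the points near [x]. *)
Lemma hamiltonian_diff_cont (K : forall x : M, cotangent A x -> R) phi x :
  hamiltonian_cont K -> C1_loc phi x ->
  {for x, continuous (fun z => K z (diff_at A phi z))}.
Proof.
move=> cK fx; set e := chart_at A x.
have ex : chart_dom e x := chart_at_dom A x.
have Ae : atlas A e := chart_at_atlas A x.
have fnx : C1_near phi x := nbhs_singleton fx.
pose G (z : M) := (e z, grad (phi \o chart_inv e) (e z)).
have cG : {for x, continuous G}.
  apply: (@cvg_pair _ _ _ (nbhs x) (nbhs (e x))
    (nbhs (grad (phi \o chart_inv e) (e x))) _ _ _ e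
    (fun z => grad (phi \o chart_inv e) (e z))); first exact: chart_map_cont.
  apply: (@continuous_comp _ _ _ e (grad (phi \o chart_inv e))).
    exact: chart_map_cont.
  apply: continuous_at_mx => i j.
  rewrite (_ : (fun y => _) = 'D_(delta_mx 0 i) (phi \o chart_inv e)); last first.
    by apply/funext => y; rewrite mxE.
  exact: (fnx e Ae ex).2.
have := @continuous_comp _ _ _ G _ x cG
  (cK e Ae _ (grad (phi \o chart_inv e) (e x)) (chart_mapP ex)).
apply: near_eq_cont; near=> z; rewrite /G/=.
have ez : chart_dom e z by near: z; exact: nbhs_dom.
have fz : C1_near phi z by near: z.
by rewrite (chart_mapK ez) (diff_at_chart Ae ez fz).
Unshelve. all: by end_near. Qed.

End Manifold.

Lemma compact_max (R : realType) (T : topologicalType) (C : set T) (h : T -> R) :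
  C !=set0 -> compact C -> (forall x, C x -> {for x, continuous h}) ->
  exists2 c, C c & forall t, C t -> h t <= h c.
Proof.
move=> C0 cC hc.
have [|c /set_mem Cc cmax] := @compact_EVT_max T R h C C0 cC.
  by apply: continuous_in_subspaceT => x /set_mem; exact: hc.
by exists c => // t Ct; apply: cmax; exact/mem_set.
Qed.

(** * Coordinate balls and bump functions *)

Section CoordinateBalls.
Variables (R : realType) (n : nat) (M : topologicalType) (A : smooth_atlas R n M).
Implicit Types (e : chart R n M) (x z : M) (phi : M -> R).

Definition coord_ball e (y : 'rV[R]_n) (r : R) : set M :=
  [set z | chart_dom e z /\ sqd y (e z) <= r].

Lemma compact_coord_ball e y r : [set w | sqd y w <= r] `<=` chart_cod e ->
  compact (coord_ball e y r).
Proof.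
move=> rcod.
have -> : coord_ball e y r = chart_inv e @` [set w | sqd y w <= r].
  apply/seteqP; split=> [z [ez zr]|_ [w wr <-]].
    by exists (e z) => //; exact: chart_mapK.
  split; first by apply: chart_invP; exact: rcod.
  by rewrite chart_invK//; exact: rcod.
apply: continuous_compact; last exact: compact_sqd.
apply: continuous_in_subspaceT => w /set_mem wr.
by apply: chart_inv_cont; exact: rcod.
Qed.

Lemma coord_ball_nbhs e x (N : set M) : chart_dom e x -> nbhs x N ->
  exists r : R, [/\ 0 < r, [set w | sqd (e x) w <= r] `<=` chart_cod e &
    coord_ball e (e x) r `<=` N].
Proof.
move=> ex Nx.
have : nbhs (e x) [set w | chart_cod e w /\ N (chart_inv e w)].
  by apply: filterS2 (nbhs_cod ex) (near_chart_inv ex Nx) => w.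
move=> /sqd_nbhs[r r0 H]; exists (r / 2); split; first by lra.
- by move=> w /= wr; apply: (H w _).1; lra.
- move=> z [ez zr]; rewrite -(chart_mapK ez).
  by apply: (H (e z) _).2; lra.
Qed.

Lemma near_coord_ball e y z (r : R) : chart_dom e z -> sqd y (e z) < r ->
  \forall t \near z, coord_ball e y r t.
Proof.
move=> ez zr.
have c : {for z, continuous (sqd y \o e)}.
  apply: (@continuous_comp _ _ _ e (sqd y)); first exact: (chart_map_cont ez).
  exact: sqd_cont.
near=> t; split; first by near: t; exact: nbhs_dom.
apply: ltW; near: t; exact: (cvgr_lt _ c).
Unshelve. all: by end_near. Qed.

Lemma C1_near_sqd e y z : atlas A e -> chart_dom e z -> C1_near A (sqd y \o e) z.
Proof. by move=> Ae ez; apply: C1_near_chart => //; exact: C1_at_sqd. Qed.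

Lemma C1_loc_chart e (f : 'rV[R]_n -> R) x : atlas A e -> chart_dom e x ->
  (\forall y \near e x, C1_at f y) -> C1_loc A (f \o e) x.
Proof.
move=> Ae ex fx.
have := near_chart_map ex fx; have := nbhs_dom ex.
by apply: filterS2 => z ez fz; exact: C1_near_chart.
Qed.

(** Fermat's rule at the minimum of the squared distance. Adding it to a test function, or
    subtracting it, keeps the differential at the centre. *)
Lemma diff_at_sqd e x : atlas A e -> chart_dom e x ->
  diff_at A (sqd (e x) \o e) x = 0 :> 'cV[R]_n.
Proof.
move=> Ae ex; apply: oppr_inj; rewrite oppr0 -diff_atN; last exact: C1_near_sqd.
apply: diff_at_max; first by apply: C1_nearN; exact: C1_near_sqd.
by near=> z; rewrite /= sqdxx oppr0 oppr_le0 sqd_ge0.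
Unshelve. all: by end_near. Qed.

Lemma coord_bump (hM : hausdorff_space M) x (N : set M) : nbhs x N ->
  exists chi (S : set M), [/\ C1_fun A chi, forall z, 0 <= chi z <= 1,
    \forall z \near x, chi z = 1, closed S /\ S `<=` N &
    forall z, ~ S z -> chi z = 0].
Proof.
move=> Nx; set e := chart_at A x.
have ex : chart_dom e x := chart_at_dom A x.
have Ae : atlas A e := chart_at_atlas A x.
have [r [r0 rcod rN]] := coord_ball_nbhs ex Nx.
(* The factor [2 / r] gives the value 1 up to squared radius [r / 2] and 0 from [r] on. *)
pose f (w : 'rV[R]_n) := step (2 / r * sqd (e x) w).
pose chi z := if pselect (chart_dom e z) then f (e z) else 0.
pose S := coord_ball e (e x) r.
(* Closedness in the whole of M, from the Hausdorff property, makes the extension of [chi] by 0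
   outside the chart C^1. *)
have clS : closed S by apply: compact_closed => //; exact: compact_coord_ball.
have chi0 z : ~ S z -> chi z = 0.
  rewrite /chi; case: pselect => // ez Sz.
  rewrite /f step_ge2//; have : r < sqd (e x) (e z).
    by rewrite ltNge; apply/negP => zr; exact: Sz.
  by rewrite mulrAC ler_pdivlMr//; lra.
exists chi, S; split => //.
- apply/C1_funP => z; have [ez|ez] := pselect (chart_dom e z).
    apply: (@C1_near_eq _ _ _ _ (f \o e)).
      have := nbhs_dom ez; apply: filterS => t et.
      by rewrite /chi; case: pselect.
    apply: C1_near_chart => //.
    have -> : f = step \o (cst (2 / r) \* sqd (e x)) by [].
    apply: C1_at_comp1; last exact: C1_at_step.
    by apply: C1_atM; [exact: C1_at_cst|exact: C1_at_sqd].
  apply: (@C1_near_eq _ _ _ _ (cst 0)); last exact: C1_near_cst.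
  have : nbhs z (~` S).
    apply: open_nbhs_nbhs; split; first exact: closed_openC.
    by move=> [/ez].
  by apply: filterS => t /chi0.
- by move=> z; rewrite /chi; case: pselect => ? /=; [exact: step01|rewrite lexx ler01].
- have := near_coord_ball ex (_ : sqd (e x) (e x) < r / 2).
  rewrite sqdxx divr_gt0// => /(_ isT); apply: filterS => z [ez zr].
  rewrite /chi; case: pselect => //= ?; apply: step_le1.
  by rewrite mulrAC ler_pdivrMr//; lra.
Qed.

End CoordinateBalls.

(** * C^1 majorants of continuous functions *)

Section Majorant.
Variables (R : realType) (n : nat) (M : topologicalType) (A : smooth_atlas R n M).
Hypotheses (hM : hausdorff_space M) (cM : @second_countable M).

(* Locally finite because prod_(i < k) (1 - chi_i) vanishes where some chi_i = 1. *)
Let prodC (chi : nat -> M -> R) (k : nat) (x : M) : R := \prod_(i < k) (1 - chi i x).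
Let psum (c : nat -> R) (chi : nat -> M -> R) (k : nat) (x : M) : R :=
  \sum_(i < k) c i * (chi i x * prodC chi i x).

(** The weights [chi i x * prodC chi i x] are nonnegative with partial sums [1 - prodC chi k x],
    equal to 1 once some earlier bump is 1. The value of [psum] is then an average of constants
    [c i] that dominate [v x] wherever their weight is nonzero. *)
Lemma C1_majorant_of_bumps (v : M -> R) (c : nat -> R) (chi : nat -> M -> R) :
  (forall k, C1_fun A (chi k)) -> (forall k x, 0 <= chi k x <= 1) ->
  (forall k x, chi k x != 0 -> v x <= c k) ->
  (forall x : M, exists k, \forall z \near x, chi k z = 1) ->
  exists m, C1_fun A m /\ forall x, v x <= m x.
Proof.
move=> C1chi chi01 vc cover.
have P0 k x : 0 <= prodC chi k x.
  by apply: prodr_ge0 => i _; have := chi01 i x; lra.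
have Pj j k x : chi j x = 1 -> (j < k)%N -> prodC chi k x = 0.
  move=> cj jk; rewrite /prodC (bigD1 (Ordinal jk))//= cj subrr mul0r//.
have Sj j k x : chi j x = 1 -> (j < k)%N -> psum c chi k x = psum c chi j.+1 x.
  move=> cj; elim: k => // k IH; rewrite ltnS leq_eqVlt => /orP[/eqP-> //|jk].
  by rewrite /psum big_ord_recr/= -/(psum c chi k x) IH// (Pj j)// !mulr0 addr0.
have vS k x : v x * (1 - prodC chi k x) <= psum c chi k x.
  elim: k => [|k IH]; first by rewrite /prodC /psum !big_ord0 subrr mulr0.
  rewrite /psum big_ord_recr/= -/(psum c chi k x).
  rewrite {1}/prodC big_ord_recr/= -/(prodC chi k x).
  have H : v x * (chi k x * prodC chi k x) <= c k * (chi k x * prodC chi k x).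
    have [->|/vc vck] := eqVneq (chi k x) 0; first by rewrite mul0r !mulr0.
    by rewrite ler_wpM2r// mulr_ge0//; have /andP[] := chi01 k x.
  by move: H IH; lra.
have C1P k x : C1_near A (prodC chi k) x.
  elim: k => [|k IH].
    rewrite (_ : prodC chi 0 = cst 1); first exact: C1_near_cst.
    by apply/funext => z; rewrite /prodC big_ord0.
  rewrite (_ : prodC chi k.+1 = prodC chi k \* (cst 1 \+ \- chi k)).
    apply: C1_nearM => //; apply: C1_nearD; first exact: C1_near_cst.
    by apply: C1_nearN; move/C1_funP : (C1chi k); exact.
  by apply/funext => z; rewrite /prodC big_ord_recr.
have C1S k x : C1_near A (psum c chi k) x.
  elim: k => [|k IH].
    rewrite (_ : psum c chi 0 = cst 0); first exact: C1_near_cst.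
    by apply/funext => z; rewrite /psum big_ord0.
  rewrite (_ : psum c chi k.+1 =
    psum c chi k \+ (cst (c k) \* (chi k \* prodC chi k))).
    apply: C1_nearD => //; apply: C1_nearM; first exact: C1_near_cst.
    by apply: C1_nearM => //; move/C1_funP : (C1chi k); exact.
  by apply/funext => z; rewrite /psum big_ord_recr.
have /choice[idx idxP] x : exists k, chi k x = 1.
  by have [k /nbhs_singleton] := cover x; exists k.
pose m x := psum c chi (idx x).+1 x.
(* The partial sums no longer change after an index whose bump is 1. The choice of [idx] is thus
   immaterial, and near each point [m] is one fixed partial sum. *)
have mE k x : chi k x = 1 -> m x = psum c chi k.+1 x.
  move=> kx; rewrite /m.
  have [ik|ki|-> //] := ltngtP (idx x) k.
    by rewrite [RHS](Sj (idx x))// ltnW.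
  by rewrite [LHS](Sj k)// ltnW.
exists m; split=> [|x].
  apply/C1_funP => x; have [k kx] := cover x.
  apply: C1_near_eq (C1S k.+1 x).
  by apply: filterS kx => z /mE.
have := vS (idx x).+1 x; rewrite (Pj (idx x))// subr0 mulr1; exact.
Qed.

(** A countable base turns the local bumps into a sequence: to each base set on which a suitable
    bump equals 1, such a bump is attached, at the index given by an injective code. *)
Lemma C1_majorant (v : M -> R) : continuous v ->
  exists m, C1_fun A m /\ forall x, v x <= m x.
Proof.
move=> cv; have [B cB [Bo Bnbhs]] := cM.
pose good (p : (M -> R) * R) (b : set M) := [/\ C1_fun A p.1,
  forall x, 0 <= p.1 x <= 1, forall x, p.1 x != 0 -> v x <= p.2 &
  forall x, b x -> p.1 x = 1].
have /countable_injP[code codeI] := cB.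
have /choice[F FP] (k : nat) : exists p, good p set0 /\
    forall b, B b -> code b = k -> (exists p', good p' b) -> good p b.
  have [[b [Bb bk [p pb]]]|nb] :=
    pselect (exists b, [/\ B b, code b = k & exists p', good p' b]).
    exists p; split; first by case: pb; split.
    move=> b' Bb' b'k _; suff -> : b' = b by [].
    by apply: codeI; rewrite ?inE// bk.
  (* An index that codes no suitable base set receives the zero bump. *)
  exists (cst 0, 0); split; last first.
    by move=> b Bb bk gb; exfalso; apply: nb; exists b.
  split => //=.
  - by apply/C1_funP => x; exact: C1_near_cst.
  - by move=> x; rewrite lexx ler01.
  - by move=> x; rewrite eqxx.
apply: (@C1_majorant_of_bumps v (fun k => (F k).2) (fun k => (F k).1)).
- by move=> k; have [[]] := FP k.
- by move=> k x; have [[_ + _ _] _] := FP k; apply.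
- by move=> k x; have [[_ _ + _] _] := FP k; apply.
move=> x.
have Nx : nbhs x [set z | v z < v x + 1].
  by apply: (cvgr_lt _ (cv x)); rewrite ltrDl.
have [chi [S [C1chi chi01 chi1 [_ SN] chi0]]] := coord_bump A hM Nx.
have [b [Bb bx] bchi] := Bnbhs x _ chi1.
exists (code b); have [_ /(_ b Bb erefl) gb] := FP (code b).
have {gb}[_ _ _ b1] : good (F (code b)) b.
  apply: gb; exists (chi, v x + 1); split => //= z cz.
  have [Sz|/chi0 z0] := pselect (S z); first by apply: ltW; exact: SN.
  by rewrite z0 eqxx in cz.
by apply: filterS (open_nbhs_nbhs (conj (Bo _ Bb) bx)) => z /b1.
Qed.

End Majorant.

(** * Local subsolutions: test functions, reflection, stability *)

Section Viscosity.
Variables (R : realType) (n : nat) (M : topologicalType) (A : smooth_atlas R n M).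
Implicit Types (x z : M) (phi u v f : M -> R) (K : forall x : M, cotangent A x -> R).

(* The right-hand side f may depend on v: the equation lambda v + H(x, dv) = c is
   encoded by f = c - lambda v. Unlike in [viscosity_subsolution], the test
   functions are C^1 and touch v only near x. *)
Definition local_subsolution K v f :=
  continuous v /\ forall phi x, C1_loc A phi x ->
    (\forall z \near x, v z - phi z <= v x - phi x) -> K x (diff_at A phi x) <= f x.

(* Phi interpolates between phi near x0 and a C^1 majorant of v away from x0. *)
Lemma global_test (hM : hausdorff_space M) (cM : @second_countable M) v phi x0 :
  continuous v -> C1_loc A phi x0 ->
  (\forall z \near x0, v z - phi z <= v x0 - phi x0) ->
  exists Phi, [/\ C1_fun A Phi, forall z, v z - Phi z <= v x0 - Phi x0 &
    diff_at A Phi x0 = diff_at A phi x0 :> 'cV[R]_n].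
Proof.
move=> cv C1phi mphi.
have [chi [S [C1chi chi01 chi1 [clS SN] chi0]]] :=
  coord_bump A hM (filterI C1phi mphi).
have [m [C1m vm]] := C1_majorant A hM cM cv.
pose m' := m \+ cst (phi x0 - v x0).
pose Phi := (chi \* phi) \+ ((cst 1 \+ \- chi) \* m').
have C1m' z : C1_near A m' z.
  by apply: C1_nearD; [move/C1_funP: C1m; exact|exact: C1_near_cst].
have Phix0 : Phi x0 = phi x0.
  by rewrite /Phi/= (nbhs_singleton chi1) subrr mul0r addr0 mul1r.
exists Phi; split.
- apply/C1_funP => z.
  have C1chiz : C1_near A chi z by move/C1_funP : C1chi; exact.
  have [Sz|Sz] := pselect (S z).
    have C1c : C1_near A (cst 1 \+ \- chi) z.
      by apply: C1_nearD; [exact: C1_near_cst|exact: C1_nearN].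
    exact: (C1_nearD (C1_nearM C1chiz (SN _ Sz).1) (C1_nearM C1c (C1m' z))).
  apply: C1_near_eq (C1m' z).
  have : nbhs z (~` S) by apply: open_nbhs_nbhs; split => //; exact: closed_openC.
  by apply: filterS => t /chi0 t0; rewrite /Phi/= t0 mul0r add0r subr0 mul1r.
- move=> z; rewrite Phix0 /Phi /m'/=.
  have [Sz|/chi0->] := pselect (S z); last first.
    by have := vm z; rewrite subr0 mul0r mul1r; lra.
  have /= := (SN _ Sz).2; have := vm z; have /andP[] := chi01 z.
  move: (chi z) (m z) => c a c0 c1 va vphi.
  have : c * (v z - phi z) <= c * (v x0 - phi x0) by exact: ler_wpM2l.
  have : (1 - c) * v z <= (1 - c) * a by apply: ler_wpM2l => //; lra.
  lra.
- apply: diff_at_near_eq; apply: filterS chi1 => z z1.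
  by rewrite /Phi/= z1 mul1r subrr mul0r addr0.
Qed.

Lemma viscosity_subsolutionP (hM : hausdorff_space M) (cM : @second_countable M)
    K v (c : R) :
  viscosity_subsolution K v c <-> local_subsolution K v (cst c).
Proof.
split=> -[cv H]; split=> //.
  move=> phi x C1phi mphi.
  have [Phi [C1Phi mPhi <-]] := global_test hM cM cv C1phi mphi.
  exact: H.
move=> phi x C1phi mphi; apply: H; last by near=> z; exact: mphi.
by near=> z; move/C1_funP : C1phi; exact.
Unshelve. all: by end_near. Qed.

(* v is a supersolution for K iff - v is a subsolution for the reflected K. *)
Definition reflect_ham K : forall x : M, cotangent A x -> R :=
  fun x p => - K x (- (p : 'cV[R]_n)).

Definition local_supersolution K v f :=
  local_subsolution (reflect_ham K) (\- v) (\- f).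

Lemma viscosity_supersolutionP (hM : hausdorff_space M) (cM : @second_countable M)
    K v (c : R) :
  viscosity_supersolution K v c <-> local_supersolution K v (cst c).
Proof.
rewrite /local_supersolution (_ : \- cst c = cst (- c)); last by apply/funext.
rewrite -viscosity_subsolutionP//; split=> -[cv H]; split.
- by move=> x; apply: continuousN; exact: cv.
- move=> phi x C1phi mphi; rewrite /reflect_ham lerN2 -diff_atN; last first.
    by move/C1_funP : C1phi; exact.
  apply: H; last by move=> z; have := mphi z; rewrite /=; lra.
  by apply/C1_funP => z; apply: C1_nearN; move/C1_funP : C1phi; exact.
- rewrite (_ : v = \- \- v); last by apply/funext => x; rewrite /= opprK.
  by move=> x; apply: continuousN; exact: cv.
- move=> phi x C1phi mphi.
  have := H (\- phi) x; rewrite /reflect_ham lerN2 diff_atN; last first.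
    by move/C1_funP : C1phi; exact.
  rewrite (opprK (diff_at A phi x : 'cV[R]_n)); apply.
    by apply/C1_funP => z; apply: C1_nearN; move/C1_funP : C1phi; exact.
  by move=> z; have := mphi z; rewrite /=; lra.
Qed.

Lemma reflect_ham_cont K : hamiltonian_cont K -> hamiltonian_cont (reflect_ham K).
Proof.
move=> cK e Ae y q ey.
rewrite /reflect_ham/=.
have neg_cont : {for (y, q), continuous
    (fun z : 'rV[R]_n * 'cV[R]_n => (z.1, - z.2))}.
  have c1 : {for (y, q), continuous (fst : 'rV[R]_n * 'cV[R]_n -> 'rV[R]_n)}.
    exact: cvg_fst.
  have c2 : {for (y, q), continuous (snd : 'rV[R]_n * 'cV[R]_n -> 'cV[R]_n)}.
    exact: cvg_snd.
  exact: (cvg_pair c1 (continuousN c2)).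
have := @continuous_comp _ _ _ (fun z : 'rV[R]_n * 'cV[R]_n => (z.1, - z.2)) _
  (y, q) neg_cont (cK e Ae y (- q) ey).
move=> /continuousN; apply: near_eq_cont; near=> z.
by rewrite !fctE/= mulmxN.
Unshelve. all: by end_near. Qed.

Lemma local_subsolutionD_cst K v f (a : R) :
  local_subsolution K v f -> local_subsolution K (v \+ cst a) f.
Proof.
move=> [cv H]; split.
  by move=> x; apply: continuousD; [exact: cv|exact: cst_continuous].
move=> phi x C1phi mphi; apply: H => //.
by apply: filterS mphi => z /=; lra.
Qed.

(* Adding the squared distance to x0 in a chart makes phi touch u strictly, so that
   a nearby v is touched by it at a point close to x0. *)
Lemma local_subsolution_stable K u phi x0 (f0 : R) : hamiltonian_cont K ->
  C1_loc A phi x0 -> (\forall z \near x0, u z - phi z <= u x0 - phi x0) ->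
  (forall eps : R, 0 < eps -> exists2 N, nbhs x0 N &
    forall delta : R, 0 < delta -> exists v f,
    [/\ local_subsolution K v f, forall z, N z -> v z <= u z + delta,
        u x0 - delta <= v x0 & forall z, N z -> f z <= f0 + eps]) ->
  K x0 (diff_at A phi x0) <= f0.
Proof.
move=> cK C1phi mphi H; rewrite leNgt; apply/negP => f0K.
set e := chart_at A x0.
have ex : chart_dom e x0 := chart_at_dom A x0.
have Ae : atlas A e := chart_at_atlas A x0.
pose s := sqd (e x0) \o e.
have C1s z : chart_dom e z -> C1_near A s z by exact: C1_near_sqd.
pose phi' := phi \+ s.
have C1phi' : C1_loc A phi' x0.
  apply: filterS2 C1phi (nbhs_dom ex) => z phiz ez.
  exact: (C1_nearD phiz (C1s z ez)).
have dphi' : diff_at A phi' x0 = diff_at A phi x0 :> 'cV[R]_n.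
  rewrite diff_atD; [|exact: nbhs_singleton C1phi|exact: C1s].
  by rewrite diff_at_sqd// addr0.
pose g z := K z (diff_at A phi' z).
have cg : {for x0, continuous g} by exact: hamiltonian_diff_cont.
have gx0 : g x0 = K x0 (diff_at A phi x0) by rewrite /g dphi'.
pose eps := (g x0 - f0) / 2.
have eps0 : 0 < eps by rewrite /eps; lra.
(* [N] comes before [delta]: the radius [r] below depends on [N], and [delta] on [r]. *)
have [N Nx0 {}H] := H eps eps0.
have Ng : \forall z \near x0, f0 + eps < g z.
  by apply: (cvgr_gt _ cg); rewrite /eps; lra.
have [r [r0 rcod rN]] := coord_ball_nbhs ex
  (filterI Nx0 (filterI Ng (filterI mphi (near_join C1phi')))).
(* The errors at [x0] and at [z] add up to [2 * r / 3], less than the [r] gained by [phi'] on the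
   boundary sphere, so the maximum of [v - phi'] is interior. *)
have [v [f [[cv subv] vu vx0 fN]]] := H (r / 3) (divr_gt0 r0 (ltr0Sn _ _)).
have inB : coord_ball e (e x0) r x0 by split => //; rewrite sqdxx ltW.
have [z Bz zmax] : exists2 c, coord_ball e (e x0) r c &
    forall t, coord_ball e (e x0) r t -> v t - phi' t <= v c - phi' c.
  apply: (@compact_max _ _ _ (v \- phi')); first by exists x0.
    exact: compact_coord_ball.
  move=> t /rN[_ [_ [_ /nbhs_singleton/C1_near_cont c]]].
  by apply: continuousB => //; exact: cv.
have [Nz [gz [phiz C1z]]] := rN z Bz.
have [ez sz] := Bz.
have szr : s z < r.
  rewrite lt_neqAle sz andbT; apply/negP => /eqP szr.
  have := zmax x0 inB; have := vu z Nz; have := phiz.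
  rewrite /phi'/= -/(s z) szr /s/= sqdxx; move: vx0; lra.
have := subv phi' z C1z; rewrite -/(g z) => gf.
have : g z <= f z.
  by apply: gf; have := near_coord_ball ez szr; apply: filterS => t; exact: zmax.
by have := fN z Nz; move: gz => /=; lra.
Qed.

End Viscosity.

(** * Lipschitz estimate by comparison with cones *)

Section LipschitzEstimate.
Variables (R : realType) (n : nat) (M : topologicalType) (A : smooth_atlas R n M).
Implicit Types (e : chart R n M) (x z : M) (phi u v f : M -> R).

Section Cone.
Variables (L c a : R).

(** Here [t] stands for a squared distance, so [L * Num.sqrt t] is the cone of slope [L]. The second
    term is a penalty, zero up to [t = a], that keeps the profile C^1 away from the vertex. *)
Let h (t : R) : R := L * Num.sqrt t + c * pos_sq (t - a).
Let dh (t : R) : R := L * (2 * Num.sqrt t)^-1 + c * (2 * Num.max 0 (t - a)).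

Lemma cone_is_derive (t : R) : 0 < t -> is_derive t 1 h (dh t).
Proof.
move=> t0; have := is_derive1_sqrt t0 => s.
have p : is_derive t 1 (fun t => pos_sq (t - a)) (2 * Num.max 0 (t - a)).
  have := @is_derive_pos_sq R (t - a) => p.
  have sh : is_derive t 1 (fun t : R => t - a) 1.
    by have -> : (fun t : R => t - a) = id - cst a by []; apply: is_derive_eq; rewrite subr0.
  have := @is_derive1_comp R pos_sq (fun t => t - a) t _ _ p sh; rewrite mulr1; exact.
exact: (is_deriveD (is_deriveZ L s) (is_deriveZ c p)).
Qed.

Lemma cone_C1 (t : R) : 0 < t -> C1_at h t.
Proof.
move=> t0; apply: (@C1_at_is_derive _ _ dh).
  near=> s; apply: cone_is_derive; near: s; exact: lt_nbhsr.
apply: continuousD; apply: continuousM.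
- exact: cst_continuous.
- apply: continuousV; first by rewrite mulf_neq0// gt_eqF// sqrtr_gt0.
  by apply: continuousM; [exact: cst_continuous|exact: sqrt_continuous].
- exact: cst_continuous.
- apply: continuousM; first exact: cst_continuous.
  apply: (@continuous_max _ _ (cst 0) (fun t => t - a)).
    exact: cst_continuous.
  by apply: continuousB; [move=> ?; exact|exact: cst_continuous].
Unshelve. all: by end_near. Qed.

Lemma cone_continuous : continuous h.
Proof.
move=> t; suff : {for t, continuous h} by [].
apply: continuousD; apply: continuousM.
- exact: cst_continuous.
- exact: sqrt_continuous.
- exact: cst_continuous.
- apply: (@continuous_comp _ _ _ (fun t => t - a) pos_sq).
    by apply: continuousB; [move=> ?; exact|exact: cst_continuous].
  exact: (C1_at_cont (C1_at_pos_sq _)).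
Qed.

(** The gradient is radial; its length is [L] plus the nonnegative contribution of the penalty. *)
Lemma csq_grad_cone (y z : 'rV[R]_n) : 0 <= L -> 0 <= c -> 0 < sqd y z ->
  L ^+ 2 <= csq (grad (h \o sqd y) z).
Proof.
move=> L0 c0 s0; rewrite (grad_radial (cone_is_derive s0)) csqZ csq_sqd.
have q0 : 0 < Num.sqrt (sqd y z) by rewrite sqrtr_gt0.
have E : 2 * dh (sqd y z) * Num.sqrt (sqd y z) =
    L + 4 * c * Num.max 0 (sqd y z - a) * Num.sqrt (sqd y z).
  by rewrite /dh; field; rewrite gt_eqF.
have LE : L <= 2 * dh (sqd y z) * Num.sqrt (sqd y z).
  by rewrite E lerDl !mulr_ge0 ?le_max ?lexx// ltW.
apply: (@le_trans _ _ ((2 * dh (sqd y z) * Num.sqrt (sqd y z)) ^+ 2)).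
  by rewrite lerXn2r ?nnegrE// (le_trans L0).
by rewrite exprMn sqr_sqrtr// ltW.
Qed.

End Cone.

(* The slope L cone centred at y, made steep beyond the radius r / 2, can only
   touch v from above at its vertex. *)
Lemma lipschitz_of_tests e y v (r L : R) : atlas A e -> continuous v ->
  0 < r -> 0 < L -> [set w | sqd y w <= r] `<=` chart_cod e ->
  (forall phi z, C1_loc A phi z ->
     (\forall t \near z, v t - phi t <= v z - phi z) -> coord_ball e y r z ->
     csq (grad (phi \o chart_inv e) (e z)) < L ^+ 2) ->
  forall w, sqd y w <= r / 2 ->
    v (chart_inv e w) <= v (chart_inv e y) + L * Num.sqrt (sqd y w).
Proof.
move=> Ae cv r0 L0 rcod tests w wr.
have cB : compact (coord_ball e y r) by exact: compact_coord_ball.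
have cod w' : sqd y w' <= r -> chart_cod e w' by exact: rcod.
have Bin w' : sqd y w' <= r -> coord_ball e y r (chart_inv e w').
  move=> w'r; split; first by apply: chart_invP; exact: cod.
  by rewrite chart_invK//; exact: cod.
have yr : sqd y y <= r by rewrite sqdxx ltW.
set x1 := chart_inv e y.
have Bx1 : coord_ball e y r x1 by exact: Bin.
have [zm Bm vm] := @compact_max _ _ _ v (ex_intro _ _ Bx1) cB (fun x _ => cv x).
(* On the boundary the penalty is [c * a ^+ 2 = v zm - v x1 + 1], more than [v] can rise above its
   value at the vertex; the maximum of [v - psi] is therefore interior. *)
pose a := r / 2; pose c := (v zm - v x1 + 1) / a ^+ 2.
have a0 : 0 < a by rewrite /a; lra.
have c0 : 0 <= c.
  by rewrite divr_ge0 ?sqr_ge0//; have := vm _ Bx1; lra.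
pose h (t : R) : R := L * Num.sqrt t + c * pos_sq (t - a).
pose psi := (h \o sqd y) \o e.
have cpsi z : chart_dom e z -> {for z, continuous psi}.
  move=> ez; apply: (@continuous_comp _ _ _ e (h \o sqd y)).
    exact: (chart_map_cont ez).
  apply: (@continuous_comp _ _ _ (sqd y) h); first exact: sqd_cont.
  exact: cone_continuous.
have [z Bz zmax] := @compact_max _ _ _ (v \- psi) (ex_intro _ _ Bx1) cB
  (fun x Bx => continuousB (cv x) (cpsi x Bx.1)).
have [ez sz] := Bz.
have h0 : h 0 = 0 by rewrite /h sqrtr0 mulr0 pos_sq0 ?mulr0 ?addr0//; lra.
have psix1 : psi x1 = 0.
  by rewrite /psi/= chart_invK ?sqdxx//; exact: cod.
have szr : sqd y (e z) < r.
  rewrite lt_neqAle sz andbT; apply/negP => /eqP szr.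
  have := zmax _ Bx1; rewrite /= psix1 /psi/= szr /h.
  have -> : r - a = a by rewrite /a; lra.
  rewrite pos_sqE ?(ltW a0)// /c mulfVK ?expf_eq0 ?(gt_eqF a0)//.
  have : 0 <= L * Num.sqrt r by rewrite mulr_ge0 ?sqrtr_ge0// ltW.
  have := vm _ Bz; lra.
have ezy : e z = y.
  apply: sqd_eq0; rewrite leNgt; apply/negP => s0.
  have C1psi : C1_loc A psi z.
    apply: C1_loc_chart => //; near=> t.
    apply: C1_at_comp1; first exact: C1_at_sqd.
    apply: cone_C1; near: t; exact: (cvgr_gt _ (@sqd_cont R n y (e z))).
  have mz : \forall t \near z, v t - psi t <= v z - psi z.
    by have := near_coord_ball ez szr; apply: filterS => t; exact: zmax.
  have := tests psi z C1psi mz Bz.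
  have -> : grad (psi \o chart_inv e) (e z) = grad (h \o sqd y) (e z).
    apply/matrixP => i j; rewrite !mxE; apply: near_eq_derive.
    have := nbhs_cod ez; apply: filterS => t et.
    by rewrite /psi/= chart_invK.
  by rewrite ltNge csq_grad_cone// ltW.
have zx1 : z = x1 by rewrite /x1 -ezy chart_mapK.
have wr' : sqd y w <= r by lra.
have psiw : psi (chart_inv e w) = L * Num.sqrt (sqd y w).
  rewrite /psi/= (chart_invK (cod _ wr')) /h pos_sq0 ?mulr0 ?addr0//.
  by rewrite /a; lra.
by have := zmax _ (Bin _ wr'); rewrite zx1 /= psix1 psiw; lra.
Unshelve. all: by end_near. Qed.

(** If [f x0 < c], no test function touches [v] from above near [x0]. The cone estimate then holds
    vacuously for every slope [L > 0], so [v] has a local maximum at [x0], where a constant does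
    touch it. *)
Lemma subsolution_rhs_ge (K : forall x : M, cotangent A x -> R) v f (c : R) :
  (forall x (p : cotangent A x), c <= K x p) -> local_subsolution K v f ->
  continuous f -> forall x, c <= f x.
Proof.
move=> Kc [cv subv] cf x0; rewrite leNgt; apply/negP => fc.
set e := chart_at A x0.
have ex : chart_dom e x0 := chart_at_dom A x0.
have Ae : atlas A e := chart_at_atlas A x0.
have Nx : nbhs x0 [set z | f z < c] by exact: (cvgr_lt _ (cf x0)).
have [r [r0 rcod rN]] := coord_ball_nbhs ex Nx.
suff vx : \forall z \near x0, v z - (cst 0 : M -> R) z <= v x0 - (cst 0 : M -> R) x0.
  have C1c : C1_loc A (cst 0) x0 by near=> z; exact: C1_near_cst.
  by have := subv _ _ C1c vx; have := Kc x0 (diff_at A (cst 0) x0); lra.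
have tests L phi z : C1_loc A phi z ->
     (\forall t \near z, v t - phi t <= v z - phi z) -> coord_ball e (e x0) r z ->
     csq (grad (phi \o chart_inv e) (e z)) < L ^+ 2.
  move=> C1phi mphi /rN /= fz.
  by have := subv _ _ C1phi mphi; have := Kc z (diff_at A phi z); lra.
have r2 : sqd (e x0) (e x0) < r / 2 by rewrite sqdxx; lra.
have := near_coord_ball ex r2; apply: filterS => z [ez zr].
rewrite !subr0 -(chart_mapK ez) -[in leRHS](chart_mapK ex).
apply/ler_addgt0Pr => eps eps0.
set s := Num.sqrt (sqd (e x0) (e z)).
have s0 : 0 <= s := sqrtr_ge0 _.
have L0 : 0 < eps / (s + 1) by rewrite divr_gt0//; lra.
apply: le_trans (lipschitz_of_tests Ae cv r0 L0 rcod (tests _) zr) _.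
rewrite lerD2l -/s mulrAC ler_pdivrMr; last by lra.
by nra.
Unshelve. all: by end_near. Qed.

End LipschitzEstimate.

(** * Positive definite forms *)

Section PositiveDefinite.
Variables (R : realType) (n : nat).
Implicit Types (G : 'M[R]_n) (v w : 'rV[R]_n).

Lemma posdef_ge0 G v : posdef G -> 0 <= (v *m G *m v^T) 0 0.
Proof.
move=> [_ pG]; have [->|/pG/ltW //] := eqVneq v 0.
by rewrite !mul0mx mxE.
Qed.

Lemma posdef_unit G : posdef G -> G \in unitmx.
Proof.
move=> [_ pG]; rewrite -row_free_unit -kermx_eq0; apply/eqP/row_matrixP => i.
rewrite row0; apply/eqP/negPn/negP => /pG.
have /sub_kermxP -> : (row i (kermx G) <= kermx G)%MS by exact: row_sub.
by rewrite mul0mx mxE ltxx.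
Qed.

(** Positivity at [v + w] and at [v - w]. This additive form of Cauchy-Schwarz suffices to bound the
    set that defines the dual norm. *)
Lemma posdef_young G v w : posdef G ->
  2 * `|(v *m G *m w^T) 0 0| <= (v *m G *m v^T) 0 0 + (w *m G *m w^T) 0 0.
Proof.
move=> pG; have [GT _] := pG.
have sym : (w *m G *m v^T) 0 0 = (v *m G *m w^T) 0 0.
  rewrite -[LHS]trace_mx11 -mxtrace_tr.
  by rewrite !trmx_mul trmxK GT mulmxA trace_mx11.
have mxD (X Y : 'M[R]_1) : (X + Y) 0 0 = X 0 0 + Y 0 0 by rewrite mxE.
have mxZ (t : R) (X : 'M[R]_1) : (t *: X) 0 0 = t * X 0 0 by rewrite mxE.
have E (s : R) : ((v + s *: w) *m G *m (v + s *: w)^T) 0 0 =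
    (v *m G *m v^T) 0 0 + 2 * s * (v *m G *m w^T) 0 0
    + s ^+ 2 * (w *m G *m w^T) 0 0.
  rewrite [(_ + _)^T]linearD/= [(s *: w)^T]linearZ/= !mulmxDl !mulmxDr.
  rewrite -!scalemxAl -!scalemxAr !mxD !mxZ sym; ring.
have := posdef_ge0 (v + 1 *: w) pG; have := posdef_ge0 (v + (-1) *: w) pG.
by rewrite !E; case: ler0P; lra.
Qed.

Lemma quadratic_le G v (b : R) : (forall i j, `|G i j| <= b) ->
  (v *m G *m v^T) 0 0 <= b * n%:R * csq v^T.
Proof.
move=> Gb.
have -> : (v *m G *m v^T) 0 0 = \sum_j \sum_i v 0 i * G i j * v 0 j.
  by rewrite mxE; apply: eq_bigr => j _; rewrite !mxE mulr_suml.
have -> : b * n%:R * csq v^T =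
    \sum_j \sum_i b * ((v 0 i ^+ 2 + v 0 j ^+ 2) / 2).
  under eq_bigr do rewrite -mulr_sumr -mulr_suml big_split/=.
  rewrite -mulr_sumr -mulr_suml big_split/= exchange_big/=.
  have -> : \sum_(i < n) \sum_(j < n) v 0 i ^+ 2 = n%:R * csq v^T.
    rewrite /csq mulr_sumr; apply: eq_bigr => i _.
    by rewrite sumr_const card_ord mxE mulr_natl.
  by field.
apply: ler_sum => j _; apply: ler_sum => i _.
have /ler_normlP[] := Gb i j; have := sqr_ge0 (v 0 i - v 0 j).
have := sqr_ge0 (v 0 i + v 0 j); move: (v 0 i) (v 0 j) (G i j) => x y t h1 h2 h3 h4.
(* The two products add up to [2 * b * (x ^+ 2 + y ^+ 2) - 4 * t * x * y]. *)
have : 0 <= (b + t) * (x - y) ^+ 2 by rewrite mulr_ge0//; lra.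
have : 0 <= (b - t) * (x + y) ^+ 2 by rewrite mulr_ge0//; lra.
lra.
Qed.

End PositiveDefinite.

Lemma mx_norm_coord (R : realType) m n (G : 'M[R]_(m, n)) i j : `|G i j| <= `|G|.
Proof.
rewrite [leRHS]/Num.norm/= mx_normrE.
exact: (@le_bigmax _ _ _ _ (fun ij : 'I_m * 'I_n => `|G ij.1 ij.2|) (i, j)).
Qed.

(** * Coercivity in charts and equicontinuity of subsolutions *)

Section Coercivity.
Variables (R : realType) (n : nat) (M : topologicalType) (A : smooth_atlas R n M).
Variables (g : riemannian_metric A) (H : forall x : M, cotangent A x -> R).
Implicit Types (e : chart R n M) (x z : M).

(** A real [sup] dominates its set only when the set is bounded above. The Riesz representative [w]
    of [p] turns the pairing into a metric product, which [posdef_young] bounds on the unit ball. *)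
Lemma pairing_le_dual_norm x (p : cotangent A x) (v : tangent A x) :
  tnorm g v <= 1 -> `|pairing p v| <= dual_norm g p.
Proof.
move=> v1; apply: ub_le_sup; last by exists v.
have pG := metric_posdef g x.
pose w := (invmx (g x) *m (p : 'cV[R]_n))^T.
exists ((1 + (w *m g x *m w^T) 0 0) / 2) => _ [t /= t1 <-].
have := posdef_young t w pG.
rewrite /pairing /w trmxK -[t *m g x *m _]mulmxA mulKVmx; last exact: posdef_unit.
have : (t *m g x *m t^T) 0 0 <= 1.
  by rewrite -(sqr_sqrtr (posdef_ge0 t pG)) expr_le1// sqrtr_ge0.
by rewrite ler_pdivlMr// mulrC; lra.
Qed.

Lemma dual_norm0 x : dual_norm g ((0 : 'cV[R]_n) : cotangent A x) = 0.
Proof.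
rewrite /dual_norm (_ : [set _ | _ in _] = [set 0]) ?sup1//.
apply/seteqP; split=> [_ [v _ <-]|_ ->]; first by rewrite /pairing mulmx0 mxE normr0.
exists (0 : 'rV[R]_n); last by rewrite /pairing mulmx0 mxE normr0.
by rewrite /= /tnorm mul0mx mul0mx mxE sqrtr0 ler01.
Qed.

(** The dual norm is bounded below by testing on one vector, [q^T] transported to the chart at [x]
    and scaled to metric length at most 1 by a local bound on the metric. Superlinearity of slope 1
    bounds the dual norm by [a + c]. *)
Lemma coercive_in_chart (hs : uniformly_superlinear g H) x0 (a : R) :
  exists L : R, 0 < L /\ \forall x \near x0, forall q : 'cV[R]_n,
    H (coord_change (chart_at A x) (chart_at A x0) x *m q : cotangent A x) <= a ->
    csq q < L ^+ 2.
Proof.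
have [c Hc] := hs 1 ler01; set e := chart_at A x0.
have ex0 : chart_dom e x0 := chart_at_dom A x0.
have Ae : atlas A e := chart_at_atlas A x0.
pose G (y : 'rV[R]_n) : 'M[R]_n := let x := chart_inv e y in
  coord_change e (chart_at A x) x *m g x *m (coord_change e (chart_at A x) x)^T.
have cG : {for e x0, continuous G}.
  have := metric_smooth g Ae 0%N; rewrite /Ck => /(_ _ (chart_mapP ex0)). exact.
pose b := `|G (e x0)| + 1.
have Gb : \forall x \near x0, `|G (e x)| < b.
  apply: (near_chart_map (P := [set y | `|G y| < b])) => //.
  have /cvg_norm cGn : G @ e x0 --> G (e x0) := cG.
  by apply: (cvgr_lt _ cGn); rewrite ltrDl.
(* The [+ 1] keeps [B] positive in dimension 0. *)
pose B := b * n%:R + 1.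
have B0 : 0 < B by rewrite ltr_wpDl// mulr_ge0// addr_ge0.
pose L := Num.sqrt B * (`|a + c| + 1).
have sB0 : 0 < Num.sqrt B by rewrite sqrtr_gt0.
have L0 : 0 < L by rewrite mulr_gt0// ltr_wpDl.
exists L; split=> //; near=> x => q Hq.
have ex : chart_dom e x by near: x; exact: nbhs_dom.
set e' := chart_at A x.
have ex' : chart_dom e' x := chart_at_dom A x.
have Ae' : atlas A e' := chart_at_atlas A x.
have [q0|q0] := eqVneq (csq q) 0; first by rewrite q0 exprn_gt0.
have qgt0 : 0 < csq q by rewrite lt_def q0 csq_ge0.
have sq0 : 0 < Num.sqrt (csq q) by rewrite sqrtr_gt0.
(* Chosen so that [k ^+ 2 * (B * csq q) = 1], where [B * csq q] bounds the squared metric length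
   before scaling. *)
pose k := (Num.sqrt B * Num.sqrt (csq q))^-1.
pose v : 'rV[R]_n := k *: (q^T *m coord_change e e' x).
have qq : (q^T *m q) 0 0 = csq q.
  by rewrite mxE; apply: eq_bigr => i _; rewrite mxE expr2.
have pv : pairing (coord_change e' e x *m q : cotangent A x) (v : tangent A x) =
    Num.sqrt (csq q) / Num.sqrt B.
  rewrite /pairing /v -scalemxAl mulmxA -[_ *m _ *m coord_change e' e x]mulmxA.
  rewrite (coord_changeK Ae Ae' ex ex') mulmx1 mxE qq /k -{2}(sqr_sqrtr (ltW qgt0)).
  by field; rewrite !gt_eqF.
have v1 : tnorm g (v : tangent A x) <= 1.
  have vG : (v *m g x *m v^T) 0 0 = k ^+ 2 * (q^T *m G (e x) *m q) 0 0.
    rewrite /v [(k *: _)^T]linearZ/= -!scalemxAl -!scalemxAr scalerA mxE -expr2.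
    by rewrite trmx_mul trmxK /G/= (chart_mapK ex) !mulmxA.
  have Gq : (q^T *m G (e x) *m q) 0 0 <= B * csq q.
    have bij i j : `|G (e x) i j| <= b.
      by apply: ltW; apply: le_lt_trans (_ : `|G (e x)| < b); [exact: mx_norm_coord|near: x].
    have := quadratic_le q^T bij; rewrite !trmxK => /le_trans; apply.
    by rewrite ler_wpM2r ?csq_ge0// lerDl.
  rewrite /tnorm vG -[leRHS](sqrtr1 R) ler_sqrt//.
  have -> : 1 = k ^+ 2 * (B * csq q).
    rewrite /k exprVn exprMn !sqr_sqrtr ?(ltW B0) ?(ltW qgt0)// mulVf//.
    by rewrite mulf_neq0// gt_eqF.
  by rewrite ler_wpM2l// sqr_ge0.
have := pairing_le_dual_norm (coord_change e' e x *m q : cotangent A x) v1.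
rewrite pv ger0_norm; last by rewrite divr_ge0// ltW.
have := Hc x (coord_change e' e x *m q); rewrite mul1r => h1 h2.
have : Num.sqrt (csq q) / Num.sqrt B <= a + c by lra.
rewrite ler_pdivrMr// => h3.
have qL : Num.sqrt (csq q) < L.
  rewrite /L; apply: le_lt_trans h3 _; rewrite mulrC ltr_pM2l//.
  by rewrite (le_lt_trans (ler_norm _))// ltrDl.
have : Num.sqrt (csq q) ^+ 2 < L ^+ 2.
  by rewrite ltr_pXn2r// nnegrE ltW.
by rewrite sqr_sqrtr// ltW.
Unshelve. all: by end_near. Qed.

(** The cone with vertex [x0] bounds [v x - v x0] from above; the opposite bound needs a cone with
    vertex [x], hence estimates on balls with a moving centre. *)
Lemma subsolutions_equicontinuous (hs : uniformly_superlinear g H) x0 (a eps : R) :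
  0 < eps -> \forall x \near x0, forall v f, local_subsolution H v f ->
    (forall z, f z <= a) -> `|v x - v x0| <= eps.
Proof.
move=> eps0; set e := chart_at A x0.
have ex0 : chart_dom e x0 := chart_at_dom A x0.
have Ae : atlas A e := chart_at_atlas A x0.
have [L [L0 NL]] := coercive_in_chart hs x0 a.
have [r [r0 rcod rN]] := coord_ball_nbhs ex0 NL.
(* The balls of squared radius [r / 4] about points at squared distance at most [r / 8] stay within
   [r] by [sqd_triangle], and [r / 8] is the half radius on which the cone estimate holds. The other
   term makes that estimate at most [eps]. *)
pose s := Num.min (r / 8) ((eps / L) ^+ 2).
have s0 : 0 < s by rewrite lt_min exprn_gt0 ?divr_gt0.
have sr : s <= r / 8 by rewrite ge_min lexx.
have xs : sqd (e x0) (e x0) < s by rewrite sqdxx.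
near=> x => v f [cv subv] fa.
have [ex xs'] : coord_ball e (e x0) s x.
  by near: x; exact: (near_coord_ball ex0 xs).
have sub y : sqd (e x0) y <= s -> [set w | sqd y w <= r / 4] `<=`
    [set w | sqd (e x0) w <= r].
  by move=> yr w /= wr; have := sqd_triangle (e x0) y w; lra.
have tests y : sqd (e x0) y <= s -> forall phi z, C1_loc A phi z ->
     (\forall t \near z, v t - phi t <= v z - phi z) -> coord_ball e y (r / 4) z ->
     csq (grad (phi \o chart_inv e) (e z)) < L ^+ 2.
  move=> ys phi z C1phi mphi [ez yz].
  have Bz : coord_ball e (e x0) r z by split => //; exact: (sub y).
  apply: (rN z Bz).
  rewrite -(diff_at_chart Ae ez (nbhs_singleton C1phi)).
  exact: le_trans (subv _ _ C1phi mphi) (fa z).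
have lip y w : sqd (e x0) y <= s -> sqd y w <= s ->
    v (chart_inv e w) <= v (chart_inv e y) + eps.
  move=> ys ws; have r4 : 0 < r / 4 by rewrite divr_gt0.
  have ycod : [set w | sqd y w <= r / 4] `<=` chart_cod e.
    exact: subset_trans (sub _ ys) rcod.
  apply: le_trans (lipschitz_of_tests Ae cv r4 L0 ycod (tests y ys) _) _.
    by lra.
  rewrite lerD2l -ler_pdivlMl// mulrC.
  rewrite -(ger0_norm (ltW (divr_gt0 eps0 L0))) -sqrtr_sqr ler_wsqrtr//.
  by apply: le_trans ws _; rewrite ge_min lexx orbT.
have h1 := lip (e x0) (e x) (ltW xs) xs'.
have h2 : v (chart_inv e (e x0)) <= v (chart_inv e (e x)) + eps.
  by apply: lip => //; rewrite sqdC.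
rewrite !chart_mapK// in h1 h2.
by rewrite ler_norml; lra.
Unshelve. all: by end_near. Qed.

End Coercivity.

(** * Perron's method for the discounted equation *)

Section Perron.
Variables (R : realType) (n : nat) (M : topologicalType) (A : smooth_atlas R n M).
Hypothesis hM : hausdorff_space M.
Implicit Types (x z : M) (phi u v f : M -> R).

Lemma diff_at_touching phi psi x : C1_near A phi x -> C1_near A psi x ->
  (\forall z \near x, phi z - psi z <= phi x - psi x) ->
  diff_at A phi x = diff_at A psi x :> 'cV[R]_n.
Proof.
move=> C1phi C1psi mx; have C1N := C1_nearN C1psi.
apply/eqP; rewrite -subr_eq0 -(diff_atN C1psi) -(diff_atD C1phi C1N).
by apply/eqP; exact: (diff_at_max (C1_nearD C1phi C1N) mx).
Qed.

(* Perron's bump: w is the maximum of u and of phi, lowered by the squared distance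
   to x0 and raised by a small constant. *)
Lemma subsolution_bump (K : forall x : M, cotangent A x -> R) (lambda : R) u phi x0 :
  hamiltonian_cont K -> 0 < lambda ->
  local_subsolution K u (fun x => - lambda * u x) -> C1_loc A phi x0 ->
  (\forall z \near x0, u x0 - phi x0 <= u z - phi z) ->
  K x0 (diff_at A phi x0) < - lambda * u x0 ->
  exists w, [/\ local_subsolution K w (fun x => - lambda * w x),
    forall z, u z <= w z & u x0 < w x0].
Proof.
move=> cK l0 [cu subu] C1phi mphi Ku.
set e := chart_at A x0.
have ex : chart_dom e x0 := chart_at_dom A x0.
have Ae : atlas A e := chart_at_atlas A x0.
pose s := sqd (e x0) \o e.
have C1s z : chart_dom e z -> C1_near A s z by exact: C1_near_sqd.
pose phi1 := phi \+ (\- s).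
have C1phi1 : C1_loc A phi1 x0.
  apply: filterS2 C1phi (nbhs_dom ex) => z phiz ez.
  exact: (C1_nearD phiz (C1_nearN (C1s z ez))).
have s0 : s x0 = 0 by rewrite /s/= sqdxx.
have dphi1 : diff_at A phi1 x0 = diff_at A phi x0 :> 'cV[R]_n.
  have C1sx := C1s _ ex.
  rewrite (diff_atD (nbhs_singleton C1phi) (C1_nearN C1sx)) diff_atN//.
  by rewrite diff_at_sqd// oppr0 addr0.
pose h z := K z (diff_at A phi1 z) + lambda * (phi1 z + (u x0 - phi x0)).
have ch : {for x0, continuous h}.
  apply: (@continuousD _ _ _ (fun z => K z (diff_at A phi1 z))).
    exact: hamiltonian_diff_cont.
  apply: (@continuousM _ _ (cst lambda)); first exact: cst_continuous.
  apply: (@continuousD _ _ _ phi1 (cst (u x0 - phi x0))).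
    exact: C1_near_cont (nbhs_singleton C1phi1).
  exact: cst_continuous.
have h0 : h x0 < 0.
  by rewrite /h dphi1 /phi1/= s0; move: Ku; lra.
pose eta := - h x0 / 2.
have eta0 : 0 < eta by rewrite /eta; lra.
have Nh : \forall z \near x0, h z < - eta.
  by apply: (cvgr_lt _ ch); rewrite /eta; lra.
have [r [r0 rcod rN]] := coord_ball_nbhs ex
  (filterI Nh (filterI mphi C1phi1)).
(* With [r / 4] the raised function falls below [u] well before the boundary of the ball; with
   [eta / lambda] the raise costs at most the margin [eta] in the equation. *)
pose delta := Num.min (r / 4) (eta / lambda).
have d0 : 0 < delta by rewrite lt_min; apply/andP; split; rewrite divr_gt0.
have dr : delta <= r / 4 by rewrite ge_min lexx.
have deta : lambda * delta <= eta.
  by rewrite mulrC -ler_pdivlMr// ge_min lexx orbT.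
pose B := coord_ball e (e x0) r.
pose k := u x0 - phi x0 + delta.
pose w z := if pselect (B z) then Num.max (u z) (phi1 z + k) else u z.
have uw z : u z <= w z.
  by rewrite /w; case: pselect => //= _; rewrite le_max lexx.
have wB z : B z -> w z = Num.max (u z) (phi1 z + k).
  by rewrite /w; case: pselect.
have wNB z : ~ B z -> w z = u z.
  by rewrite /w; case: pselect.
have far z : B z -> delta <= s z -> phi1 z + k <= u z.
  move=> /rN[_ [/= mz _]] ds; rewrite /phi1 /k/=; lra.
have near_wB z : chart_dom e z -> s z < r -> \forall t \near z, B t.
  exact: near_coord_ball.
have wx0 : u x0 < w x0.
  rewrite wB; last by split => //; rewrite sqdxx ltW.
  by rewrite lt_max /phi1 /k /= s0; apply/orP; right; lra.
have C1phi1B z : B z -> C1_near A phi1 z by move=> /rN[_ []].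
have cw : continuous w.
  move=> z; suff : {for z, continuous w} by [].
  have [[ez zr]|zr] := pselect (chart_dom e z /\ s z < r).
    have Bz := near_wB z ez zr.
    apply: (@near_eq_cont _ _ (fun t => Num.max (u t) (phi1 t + k))).
      by apply: filterS Bz => t /wB.
    apply: (@continuous_max _ _ u (phi1 \+ cst k)); first exact: cu.
    apply: (@continuousD _ _ _ phi1 (cst k)); last exact: cst_continuous.
    exact: C1_near_cont (C1phi1B _ (nbhs_singleton Bz)).
  apply: (@near_eq_cont _ _ u); last exact: cu.
  (* Outside the ball of squared radius [r / 2] one has [w = u], even where the maximum is taken, so
     the two formulas overlap on open sets. *)
  have clB : closed (coord_ball e (e x0) (r / 2)).
    apply: compact_closed => //; apply: compact_coord_ball.
    by move=> t /= tr; apply: rcod => /=; lra.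
  have : nbhs z (~` coord_ball e (e x0) (r / 2)).
    apply: open_nbhs_nbhs; split; first exact: closed_openC.
    move=> [ez zr2]; apply: zr; split => //.
    by apply: le_lt_trans zr2 _; lra.
  apply: filterS => t nBt; rewrite /w; case: pselect => //= Bt.
  rewrite max_l//; apply: far => //.
  rewrite leNgt; apply/negP => st; apply: nBt; split; first by case: Bt.
  by move: st; rewrite /s/=; lra.
exists w; split => //; split => // psi z C1psi mpsi.
(* Where [w = u], a test function for [w] also tests [u]. Elsewhere [phi1 + k] touches [psi] from
   below up to a constant, so the differentials agree. *)
have [wz|wz] := eqVneq (w z) (u z).
  rewrite wz; apply: subu => //; apply: filterS mpsi => t.
  by rewrite wz; have := uw t; lra.
have Bz : B z.
  by apply: contrapT => /wNB wzu; rewrite wzu eqxx in wz.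
have {}wz : w z = phi1 z + k /\ u z < phi1 z + k.
  move: wz; rewrite (wB _ Bz); case: (leP (phi1 z + k) (u z)); last by [].
  by rewrite eqxx.
have sz : s z < r.
  have : s z < delta by rewrite ltNge; apply/negP => /(far z Bz); lra.
  by lra.
have <- : diff_at A phi1 z = diff_at A psi z :> 'cV[R]_n.
  apply: diff_at_touching; [exact: C1phi1B|exact: nbhs_singleton C1psi|].
  apply: filterS2 mpsi (near_wB z Bz.1 sz) => t mt Bt.
  have : phi1 t + k <= w t by rewrite (wB _ Bt) le_max lexx orbT.
  by move: mt; rewrite wz.1; lra.
have [/= hz _] := rN z Bz.
by rewrite wz.1; move: hz; rewrite /h /k; lra.
Qed.

Section Discounted.
Variables (g : riemannian_metric A) (H : forall x : M, cotangent A x -> R).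
Hypotheses (cH : hamiltonian_cont H) (hs : uniformly_superlinear g H).
Variables (a c : R).
Hypotheses (Ha : forall x, H ((0 : 'cV[R]_n) : cotangent A x) <= a)
  (Hc : forall x (p : cotangent A x), c <= H p).

Lemma discounted_solution (lambda : R) : 0 < lambda -> exists u,
  [/\ local_subsolution H u (fun x => - lambda * u x),
      local_supersolution H u (fun x => - lambda * u x),
      forall x, - lambda * u x <= a & forall x, c <= - lambda * u x].
Proof.
move=> l0.
(* The cap [a] on the right-hand sides makes the family equicontinuous, and the bump construction
   preserves it because it only increases a function. *)
pose P v := local_subsolution H v (fun x => - lambda * v x) /\
  forall x, - lambda * v x <= a.
have Pcst : P (cst (- a / lambda)).
  split; last by move=> x /=; rewrite mulrC mulrN mulfVK ?gt_eqF// opprK.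
  split=> [|phi x C1phi mphi]; first exact: cst_continuous.
  rewrite -[_ * _]/(- lambda * (- a / lambda)) mulrC mulrN mulfVK ?gt_eqF// opprK.
  rewrite -(diff_at_touching (@C1_near_cst R n M A (- a / lambda) x) (nbhs_singleton C1phi) mphi).
  by rewrite diff_at_cst.
have Pge v : P v -> forall x, c <= - lambda * v x.
  move=> [subv _]; apply: (subsolution_rhs_ge Hc subv) => x.
  apply: (@continuousM _ _ (cst (- lambda))); first exact: cst_continuous.
  exact: subv.1.
pose S x := [set v x | v in P].
pose u x := sup (S x).
have ubS x : has_sup (S x).
  split; first by exists (- a / lambda), (cst (- a / lambda)).
  exists (- c / lambda) => _ [v Pv <-]; rewrite ler_pdivlMr//.
  by have := Pge v Pv x; lra.
have vu v : P v -> forall x, v x <= u x.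
  by move=> Pv x; apply: sup_upper_bound => //; exists v.
have approx x eps : 0 < eps -> exists2 v, P v & u x - eps < v x.
  by move=> e0; have [_ [v Pv <-] ux] := sup_adherent e0 (ubS x); exists v.
have equi x0 eps : 0 < eps ->
    \forall x \near x0, forall v, P v -> `|v x - v x0| <= eps.
  move=> e0; have := subsolutions_equicontinuous hs x0 a e0.
  by apply: filterS => x Hx v [subv va]; exact: Hx subv va.
have cu : continuous u.
  move=> x0; apply/cvgrPdist_le => eps e0.
  have e2 : 0 < eps / 2 by lra.
  apply: filterS (equi x0 _ e2) => x Hx.
  have [v Pv vx] := approx x _ e2; have [v' Pv' vx'] := approx x0 _ e2.
  have := vu v Pv x0; have := vu v' Pv' x.
  have /ler_normlP[] := Hx v Pv; have /ler_normlP[] := Hx v' Pv'.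
  by rewrite ler_norml; lra.
have ua x : - lambda * u x <= a.
  by have := vu _ Pcst x; rewrite /= ler_pdivrMr//; lra.
have subu : local_subsolution H u (fun x => - lambda * u x).
  split=> // phi x0 C1phi mphi.
  apply: (local_subsolution_stable cH C1phi mphi) => eps e0.
  (* Two errors of size [eta], from the choice of [v] at [x0] and from its oscillation on the
     neighbourhood, cost [2 * lambda * eta = eps]. *)
  pose eta := eps / (2 * lambda).
  have eta0 : 0 < eta by rewrite divr_gt0// mulr_gt0.
  have etaE : lambda * eta = eps / 2 by rewrite /eta; field; rewrite gt_eqF.
  exists [set x | forall v, P v -> `|v x - v x0| <= eta]; first exact: equi.
  move=> delta d0.
  have min0 : 0 < Num.min delta eta by rewrite lt_min d0.
  have [v Pv vx0] := approx x0 _ min0.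
  have vd : u x0 - delta <= v x0.
    by apply: le_trans (ltW vx0); rewrite lerB// ge_min lexx.
  have ve : u x0 - eta <= v x0.
    by apply: le_trans (ltW vx0); rewrite lerB// ge_min lexx orbT.
  exists v, (fun x => - lambda * v x); split => //.
  - exact: Pv.1.
  - by move=> z _; have := vu v Pv z; lra.
  - move=> z /(_ v Pv)/ler_normlP[h1 h2].
    have : lambda * (u x0 - 2 * eta) <= lambda * v z by rewrite ler_pM2l//; lra.
    by lra.
exists u; split => //.
  split=> [x|phi x C1phi mphi]; first by apply: continuousN; exact: cu.
  rewrite /reflect_ham -diff_atN; last exact: nbhs_singleton C1phi.
  rewrite -[(\- _) x]/(- (- lambda * u x)) lerN2 leNgt; apply/negP => Hlt.
  have C1Nphi : C1_loc A (\- phi) x by apply: filterS C1phi => z; exact: C1_nearN.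
  have mNphi : \forall z \near x, u x - (\- phi) x <= u z - (\- phi) z.
    by apply: filterS mphi => z /=; lra.
  (* A failure of the supersolution test would give a member of [P] exceeding the supremum at
     [x]. *)
  have [w [subw uw ux]] := subsolution_bump cH l0 subu C1Nphi mNphi Hlt.
  have Pw : P w.
    split => // z; apply: le_trans (ua z).
    by rewrite !mulNr lerN2 ler_pM2l.
  by have := vu w Pw x; lra.
apply: (Pge u); split => //.
Qed.

End Discounted.
End Perron.

(** * Limits along an ultrafilter *)

Lemma ultra_bounded_cvg (R : realType) (I : Type) (F : set_system I) (s : I -> R)
    (b : R) : UltraFilter F -> (forall k, `|s k| <= b) ->
  exists l : R, s k @[k --> F] --> l.
Proof.
move=> UF sb; have PF : ProperFilter F := ultra_proper.
have sF : (s @ F) `[- b, b]%classic.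
  apply: (@filterE _ F) => k; rewrite /= in_itv/= -ler_norml; exact: sb.
have [l [_ cl]] := @segment_compact R (- b) b (s @ F) _ sF.
(* A cluster point along an ultrafilter is a limit: otherwise the complement of [V] would be in the
   image filter and meet [V]. *)
exists l => V lV; have [//|nV] := in_ultra_setVsetC (s @^-1` V) UF.
by have [y []] := cl (~` V) V nV lV.
Qed.

Section Limits.
Variables (R : realType) (n : nat) (M : topologicalType) (A : smooth_atlas R n M).
Implicit Types (x z : M) (phi u v f : M -> R).

(** For [v] one neighbourhood serves every [eps], as stability fixes [N] before [delta]; for [f] it
    may shrink with [eps]. *)
Lemma local_subsolution_limit (K : forall x : M, cotangent A x -> R)
    (I : Type) (F : set_system I) (PF : ProperFilter F)
    (v f : I -> M -> R) (V : M -> R) (l : R) :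
  hamiltonian_cont K -> (forall k, local_subsolution K (v k) (f k)) -> continuous V ->
  (forall x, exists2 N, nbhs x N & forall eps, 0 < eps ->
    \forall k \near F, forall z, N z -> `|v k z - V z| <= eps) ->
  (forall x eps, 0 < eps -> exists2 N, nbhs x N &
    \forall k \near F, forall z, N z -> `|f k z - l| <= eps) ->
  local_subsolution K V (cst l).
Proof.
move=> cK subv cV vV fl; split=> // phi x C1phi mphi.
apply: (local_subsolution_stable cK C1phi mphi) => eps e0.
have [N1 N1x vN] := vV x; have [N2 N2x fN] := fl x eps e0.
exists (N1 `&` N2) => [|delta d0]; first exact: filterI.
have [k [vk fk]] := filter_ex (filterI (vN delta d0) fN).
exists (v k), (f k); split=> // [z [Nz _]||z [_ Nz]].
- by have /ler_normlP[] := vk z Nz; lra.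
- by have /ler_normlP[] := vk x (nbhs_singleton N1x); lra.
- by have /ler_normlP[] := fk z Nz; rewrite /cst; lra.
Qed.

Variables (g : riemannian_metric A) (H : forall x : M, cotangent A x -> R).
Hypotheses (cH : hamiltonian_cont H) (hs : uniformly_superlinear g H)
  (M_connected : connected [set: M]).

(** By equicontinuity, whether such a bound exists is locally constant in [x], so the points that
    have one form an open and closed set containing [x0]. *)
Lemma subsolution_oscillation (a : R) x0 x : exists b : R, forall v f,
  local_subsolution H v f -> (forall z, f z <= a) -> `|v x - v x0| <= b.
Proof.
pose X := [set x | exists b : R, forall v f,
  local_subsolution H v f -> (forall z, f z <= a) -> `|v x - v x0| <= b].
have nearX x1 : \forall z \near x1, X z <-> X x1.
  have := subsolutions_equicontinuous hs x1 a (@ltr01 R).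
  apply: filterS => z Hz; split=> -[b Hb]; exists (b + 1) => v f subv fa.
    have := Hz v f subv fa; have := Hb v f subv fa.
    by rewrite !ler_norml; lra.
  have := Hz v f subv fa; have := Hb v f subv fa.
  by rewrite !ler_norml; lra.
suff XT : X = setT by have : X x by rewrite XT.
apply: M_connected.
- by exists x0, 0 => v f _ _; rewrite subrr normr0.
- exists X; last by rewrite setTI.
  by rewrite openE => z Xz; have := nearX z; apply: filterS => t /iffRL; exact.
- exists X; last by rewrite setTI.
  rewrite -[X]setCK; apply: open_closedC; rewrite openE => z nXz.
  by have := nearX z; apply: filterS => t Ht /Ht.
Qed.

(** Arzela-Ascoli along [F]. Only differences of values of [u k] are bounded, hence the
    normalisation at [x0]; it leaves [f k] unchanged, as the right-hand side is separate data. *)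
Lemma viscosity_limit (x0 : M) (a l : R) (F : set_system nat) (u f : nat -> M -> R) :
  UltraFilter F ->
  (forall k, local_subsolution H (u k) (f k)) ->
  (forall k, local_supersolution H (u k) (f k)) ->
  (forall k x, f k x <= a) ->
  (forall x eps, 0 < eps -> exists2 N, nbhs x N &
    \forall k \near F, forall z, N z -> `|f k z - l| <= eps) ->
  exists v, local_subsolution H v (cst l) /\ local_supersolution H v (cst l).
Proof.
move=> UF subu superu fa fl.
have PF : ProperFilter F := ultra_proper.
pose w k := u k \+ cst (- u k x0).
have subw k : local_subsolution H (w k) (f k) by exact: local_subsolutionD_cst.
have equi x eps : 0 < eps -> \forall z \near x, forall k, `|w k z - w k x| <= eps.
  move=> e0; have := subsolutions_equicontinuous hs x a e0.
  by apply: filterS => z Hz k; exact: Hz (subw k) (fa k).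
have /choice[v wv] x : exists l : R, w k x @[k --> F] --> l.
  have [b Hb] := subsolution_oscillation a x0 x.
  apply: (@ultra_bounded_cvg _ _ _ _ b) => k.
  by have := Hb _ _ (subw k) (fa k); rewrite /w/= subrr subr0.
have wv_near x eps : 0 < eps -> \forall k \near F, `|w k x - v x| <= eps.
  by move=> e0; have /cvgrPdist_le/(_ _ e0) := wv x; apply: filterS => k; rewrite distrC.
have v_equi x z eps : (forall k, `|w k z - w k x| <= eps) -> `|v z - v x| <= eps.
  move=> Hk; apply/ler_addgt0Pr => d d0.
  have d2 : 0 < d / 2 by lra.
  have [k [kz kx]] := filter_ex (filterI (wv_near z _ d2) (wv_near x _ d2)).
  move: (Hk k) kz kx; rewrite !ler_norml; lra.
have cv : continuous v.
  move=> x; apply/cvgrPdist_le => eps e0.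
  by apply: filterS (equi x _ e0) => z /v_equi; rewrite distrC.
have unif x : exists2 N, nbhs x N & forall eps, 0 < eps ->
    \forall k \near F, forall z, N z -> `|w k z - v z| <= eps.
  have ex := chart_at_dom A x.
  have [r [r0 rcod _]] := coord_ball_nbhs ex (@filterT _ (nbhs x) _).
  exists (coord_ball (chart_at A x) (chart_at A x x) r).
    by apply: near_coord_ball => //; rewrite sqdxx.
  move=> eps e0.
  (* Near each [y], convergence at the single point [y] and equicontinuity of the [w k] and of [v]
     give three errors of [eps / 3]; compactness makes this uniform on the ball. *)
  have /compact_near_coveringP cov := compact_coord_ball rcod.
  apply: (cov _ F (fun k z => `|w k z - v z| <= eps)) => y _.
  have e3 : 0 < eps / 3 by lra.
  exists ([set z | forall k, `|w k z - w k y| <= eps / 3],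
          [set k | `|w k y - v y| <= eps / 3]).
    by split; [exact: equi|exact: wv_near].
  move=> [z k] [/= zy ky]; have := v_equi _ _ _ zy.
  by move: (zy k) ky; rewrite !ler_norml; lra.
exists v; split; first exact: (@local_subsolution_limit _ _ F _ w f).
rewrite /local_supersolution (_ : \- cst l = cst (- l)); last by apply/funext.
apply: (@local_subsolution_limit _ _ F _ (fun k => \- w k) (fun k => \- f k)).
- exact: reflect_ham_cont.
- move=> k; have := local_subsolutionD_cst (u k x0) (superu k).
  congr (local_subsolution _ _ _); apply/funext => z; rewrite /w/=.
  by rewrite opprD opprK.
- by move=> x; apply: continuousN; exact: cv.
- move=> x; have [N Nx HN] := unif x; exists N => // eps /HN.
  by apply: filterS => k Hk z /Hk; rewrite /= -opprD normrN.
- move=> x eps /(fl x)[N Nx HN]; exists N => //.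
  by apply: filterS HN => k Hk z /Hk; rewrite /= -opprD normrN.
Qed.

End Limits.

(** * The critical value *)

Section CriticalValue.
Variables (R : realType) (n : nat) (M : topologicalType) (A : smooth_atlas R n M).
Variables (g : riemannian_metric A) (H : forall x : M, cotangent A x -> R).

Lemma C2_hamiltonian_cont : C2_hamiltonian H -> hamiltonian_cont H.
Proof.
move=> C2 e Ae y q ey; have [dH _] := C2 e Ae.
by apply: (@differentiable_continuous _ _ _ (y, q)); exact: dH.
Qed.

Lemma hamiltonian_zero_section_le : uniformly_bounded g H ->
  exists a, forall x, H ((0 : 'cV[R]_n) : cotangent A x) <= a.
Proof.
move=> /(_ 0 (lexx 0)) Hlt; exists (fine (sup_on_balls g H 0)) => x.
have Hle : ((H ((0 : 'cV[R]_n) : cotangent A x))%:E <= sup_on_balls g H 0)%E.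
  apply: ereal_sup_ubound; exists x, (0 : 'cV[R]_n).
  by rewrite dual_norm0.
by rewrite -lee_fin fineK// fin_real// Hlt (lt_le_trans _ Hle)// ltNyr.
Qed.

Lemma hamiltonian_lower_bound : uniformly_superlinear g H ->
  exists c, forall x (p : cotangent A x), c <= H p.
Proof.
move=> /(_ 0 (lexx 0))[c Hc]; exists (- c) => x p.
by have := Hc x p; rewrite mul0r sub0r.
Qed.

Definition local_solution (u : M -> R) (c : R) :=
  local_subsolution H u (cst c) /\ local_supersolution H u (cst c).

Hypotheses (M_hausdorff : hausdorff_space M) (M_connected : connected [set: M])
  (M_nonempty : [set: M] !=set0).
Hypotheses (cH : hamiltonian_cont H) (hs : uniformly_superlinear g H)
  (hb : uniformly_bounded g H).

Lemma near_invS (eps : R) : 0 < eps -> \forall k \near \oo, k.+1%:R^-1 <= eps :> R.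
Proof.
move=> e0; have /cvgrPdist_le/(_ _ e0) := @cvg_harmonic R.
by apply: filterS => k; rewrite sub0r normrN ger0_norm// invr_ge0.
Qed.

Lemma local_solution_exists : exists u c, local_solution u c.
Proof.
have [x0 _] := M_nonempty.
have [a Ha] := hamiltonian_zero_section_le hb.
have [c Hc] := hamiltonian_lower_bound hs.
pose la (k : nat) : R := k.+1%:R^-1.
have la0 k : 0 < la k by rewrite invr_gt0.
have /choice[u uP] k := discounted_solution M_hausdorff cH hs Ha Hc (la0 k).
pose f k x := - la k * u k x.
have [F [UF Foo]] := @ultraFilterLemma _ \oo _.
have PF : ProperFilter F := @ultra_proper _ _ UF.
have [l fl] : exists l : R, f k x0 @[k --> F] --> l.
  apply: (@ultra_bounded_cvg _ _ _ _ (`|a| + `|c|)) => k.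
  have [_ _ fa fc] := uP k; have := fa x0; have := fc x0.
  rewrite -/(f k x0) ler_norml; have := ler_norm a; have := ler_norm (- c).
  by rewrite normrN; have := normr_ge0 a; have := normr_ge0 c; lra.
have [v lv] : exists v, local_solution v l.
  apply: (@viscosity_limit _ _ _ _ g H cH hs M_connected x0 a l F u f UF).
  - by move=> k; have [] := uP k.
  - by move=> k; have [] := uP k.
  - by move=> k x; have [_ _ fa _] := uP k; exact: fa.
  move=> x eps e0.
  have [b Hb] := subsolution_oscillation hs M_connected a x0 x.
  (* On this set every [u k] differs from [u k x0] by at most [|b| + 1], a bound free of [k];
     multiplied by [la k] it tends to 0, so [f k] has the same limit [l] as at [x0]. *)
  exists [set z | forall v h, local_subsolution H v h -> (forall z, h z <= a) ->
    `|v z - v x| <= 1]; first exact: (subsolutions_equicontinuous hs x a ltr01).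
  have e2 : 0 < eps / 2 by lra.
  have B0 : 0 < `|b| + 1 by rewrite ltr_wpDl.
  have /cvgrPdist_le/(_ _ e2) fl_e := fl.
  have la_e := Foo _ (near_invS (divr_gt0 e2 B0)).
  apply: filterS2 la_e fl_e => k /= lak lk z Hz.
  have [subk _ fa _] := uP k.
  have h1 := Hz _ _ subk fa; have h2 := Hb _ _ subk fa.
  have osc : `|u k z - u k x0| <= `|b| + 1.
    rewrite (_ : _ - _ = (u k x - u k x0) + (u k z - u k x)); last by lra.
    apply: le_trans (ler_normD _ _) (lerD _ h1).
    exact: le_trans h2 (ler_norm _).
  have -> : f k z - l = - la k * (u k z - u k x0) - (l - f k x0).
    by rewrite /f; lra.
  apply: le_trans (ler_normB _ _) _; rewrite normrM normrN (gtr0_norm (la0 k)).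
  have h3 : la k * `|u k z - u k x0| <= la k * (`|b| + 1) by rewrite ler_pM2l.
  move: lak; rewrite -/(la k) ler_pdivlMr//. lra.
by exists v, l.
Qed.

Lemma local_solution_inf :
  exists c, (exists u, local_solution u c) /\
    forall c', c' < c -> ~ exists u, local_solution u c'.
Proof.
have [x0 _] := M_nonempty.
have [c0 Hc0] := hamiltonian_lower_bound hs.
pose S := [set c | exists u, local_solution u c].
have S_inf : has_inf S.
  split; first by have [u [c uc]] := local_solution_exists; exists c, u.
  exists c0 => c [u [subu _]].
  exact: (subsolution_rhs_ge Hc0 subu (@cst_continuous _ _ c) x0).
exists (inf S); split; last first.
  move=> c' c'S Sc'; have := ge_inf S_inf.2 Sc'; lra.
(* A minimising sequence: its values stay below [inf S + 1], the common cap required by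
   [viscosity_limit], whose limit solves the equation at [inf S] itself. *)
have /choice[c cP] (k : nat) : exists c, S c /\ c < inf S + k.+1%:R^-1.
  have k0 : 0 < k.+1%:R^-1 :> R by rewrite invr_gt0.
  by have [c Sc cS] := inf_adherent k0 S_inf; exists c.
have /choice[u uP] k : exists u, local_solution u (c k) := (cP k).1.
have [F [UF Foo]] := @ultraFilterLemma _ \oo _.
have PF : ProperFilter F := @ultra_proper _ _ UF.
apply: (@viscosity_limit _ _ _ _ g H cH hs M_connected x0 (inf S + 1) _ F u
  (fun k => cst (c k)) UF).
- by move=> k; exact: (uP k).1.
- by move=> k; exact: (uP k).2.
- move=> k x; have [_ ck] := cP k; apply: le_trans (ltW ck) _.
  by rewrite lerD2l invf_le1// ler1n.
- move=> x eps e0; exists setT; first exact: filterT.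
  apply: filterS (Foo _ (near_invS e0)) => k /= ke z _.
  have [Sck ck] := cP k; have := ge_inf S_inf.2 Sck.
  move=> Sck'; rewrite ger0_norm ?subr_ge0//.
  by rewrite lerBlDl (le_trans (ltW ck))// lerD2l.
Qed.

End CriticalValue.

Theorem theorem1p1 (R : realType) (n : nat) (M : topologicalType)
    (A : smooth_atlas R n M) (g : riemannian_metric A)
    (H : forall x : M, cotangent A x -> R)
    (M_hausdorff : hausdorff_space M)
    (M_second_countable : @second_countable M)
    (M_nonempty : [set: M] !=set0)
    (M_connected : connected [set: M])
    (g_complete : complete_metric g)
    (H_C2 : C2_hamiltonian H)
    (H_superlinear : uniformly_superlinear g H)
    (H_bounded : uniformly_bounded g H)
    (H_convex : C2_strictly_convex H) :
  exists cH : R,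
    (exists u : M -> R, viscosity_solution H u cH) /\
    (forall c : R, c < cH -> ~ exists u : M -> R, viscosity_solution H u c).
Proof.
have solP u c : viscosity_solution H u c <-> local_solution H u c.
  rewrite /viscosity_solution viscosity_subsolutionP// viscosity_supersolutionP//.
have [c [[u uc] cmin]] := local_solution_inf M_hausdorff M_connected M_nonempty
  (C2_hamiltonian_cont H_C2) H_superlinear H_bounded.
exists c; split; first by exists u; apply/solP.
by move=> c' /cmin nc' [u' /solP u'c']; apply: nc'; exists u'.
Qed.
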